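(* (i) There exist constants $0<c\le C<\infty$ such that for every $f\in C([0,1])$, $c\,\|f\|_{D}\le\|f\|_{\mathfrak D}\le C\,\|f\|_D$ (as elements of $[0,\infty]$). (ii) If $(W_t)_{t\ge0}$ is a standard Wiener process, then $\|W_\cdot\|_D<\infty$ almost surely. (iii) If $(W_t)_{t\ge0}$ is a standard Wiener process, then $\|W_\cdot\|_{\mathfrak D}<\infty$ almost surely. Here $W_\cdot$ denotes the path $t\mapsto W_t$ restricted to $[0,1]$.
   Context: Let $I=[0,1]$, $I_{k,l}=[l2^{-k},(l+1)2^{-k}]$ with indicator $\chi_{k,l}$. For $f\in C(I)$ and $h>0$ set $\Delta_h^2f(x)=f(x+2h)-2f(x+h)+f(x)$ if $\{x,x+h,x+2h\}\subset I$ and $\Delta^2_hf(x)=0$ otherwise (for every real $x$). For $0\le k\le j$ and $x\in I$ define $$D^2_{j,k}f(x)=\sum_{l=0}^{2^k-1}\chi_{k,l}(x)\,2^k\int_{l2^{-k}}^{(l+1)2^{-k}}|\Delta^2_{2^{-j-1}}f(t)|\,dt,\qquad \mathfrak D^2_{j,k}f(x)=2^k\int_{x-2^{-k-1}}^{x+2^{-k-1}}|\Delta^2_{2^{-j-1}}f(t)|\,dt.$$ For $0<A\le1$ let $\Phi_{2,A}(u)=u^2$ for $0<u\le1$ and $\Phi_{2,A}(u)=\exp((u^2-1)/A)$ for $u>1$ (and $\Phi_{2,A}(0)=0$), and for measurable $g$ on $I$ let $\|g\|_{2,A}=\inf\{\lambda>0:\int_I\Phi_{2,A}(|g(x)|/\lambda)\,dx\le1\}$.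 Then $$\|f\|_D=\sup_{j\in\mathbb{N}_0}\sup_{0\le k\le j}\big\|2^{j/2}D^2_{j,k}f\big\|_{2,2^{k-j}},\qquad \|f\|_{\mathfrak D}=\sup_{j\in\mathbb{N}_0}\sup_{0\le k\le j}\big\|2^{j/2}\mathfrak D^2_{j,k}f\big\|_{2,2^{k-j}}.$$ *)

(* Defs.v *)
From HB Require Import structures.
From mathcomp Require Import all_boot all_order all_algebra.
From mathcomp Require Import all_classical all_reals all_analysis.
From mathcomp Require Import normal_distribution.
Set Implicit Arguments. Unset Strict Implicit. Unset Printing Implicit Defensive.
Import Order.TTheory GRing.Theory Num.Theory.
Import numFieldNormedType.Exports.
Local Open Scope classical_set_scope.
Local Open Scope ring_scope.

Section Norms.
Variable R : realType.

Definition I01 : set R := `[0, 1]%classic.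

Definition Delta2 (f : R -> R) (h x : R) : R :=
  if [&& x \in I01, x + h \in I01 & x + 2 * h \in I01]
  then f (x + 2 * h) - 2 * f (x + h) + f x else 0.

Definition step (j : nat) : R := (2 ^+ j.+1)^-1.

(* \int_a^b |Delta^2_{2^{-j-1}} f(t)| dt  (Lebesgue integral, finite for continuous f) *)
Definition DInt (f : R -> R) (j : nat) (a b : R) : \bar R :=
  (\int[lebesgue_measure]_(t in `[a, b]%classic) (`|Delta2 f (step j) t|)%:E)%E.

Definition D2 (j k : nat) (f : R -> R) (x : R) : R :=
  \sum_(l < 2 ^ k)
     \1_(`[l%:R / 2 ^+ k, l.+1%:R / 2 ^+ k]%classic) x * 2 ^+ k
     * fine (DInt f j (l%:R / 2 ^+ k) (l.+1%:R / 2 ^+ k)).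

Definition fD2 (j k : nat) (f : R -> R) (x : R) : R :=
  2 ^+ k * fine (DInt f j (x - (2 ^+ k.+1)^-1) (x + (2 ^+ k.+1)^-1)).

(* the Young function Phi_{2,A} (only evaluated at u >= 0) *)
Definition Phi2 (A u : R) : R :=
  if u <= 0 then 0 else if u <= 1 then u ^+ 2 else expR ((u ^+ 2 - 1) / A).

(* Orlicz (Luxemburg) norm ||g||_{2,A} on I, valued in [0, +oo]
   (the infimum of the empty set is +oo) *)
Definition orlicz (A : R) (g : R -> R) : \bar R :=
  ereal_inf [set lam%:E | lam in
    [set lam : R | 0 < lam /\
       (\int[lebesgue_measure]_(x in I01) (Phi2 A (`|g x| / lam))%:E <= 1)%E]].

Definition normD (f : R -> R) : \bar R :=
  ereal_sup [set orlicz (2 ^+ jk.2 / 2 ^+ jk.1)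
                 (fun x => Num.sqrt (2 ^+ jk.1) * D2 jk.1 jk.2 f x)
            | jk in [set jk : nat * nat | (jk.2 <= jk.1)%N]].

Definition normfD (f : R -> R) : \bar R :=
  ereal_sup [set orlicz (2 ^+ jk.2 / 2 ^+ jk.1)
                 (fun x => Num.sqrt (2 ^+ jk.1) * fD2 jk.1 jk.2 f x)
            | jk in [set jk : nat * nat | (jk.2 <= jk.1)%N]].

End Norms.

Definition wiener_process d (T : measurableType d) (R : realType)
    (P : probability T R) (W : R -> T -> R) : Prop :=
  [/\ (forall t, 0 <= t -> measurable_fun [set: T] (W t)),
      {ae P, forall w, W 0 w = 0},
      {ae P, forall w, {within `[0, +oo[%classic, continuous (fun t => W t w)}},
      (forall (n : nat) (ts : nat -> R) (B : nat -> set R),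
          0 <= ts 0%N -> (forall i, (i < n)%N -> ts i < ts i.+1) ->
          (forall i, (i < n)%N -> measurable (B i)) ->
          P (\bigcap_(i in [set i | (i < n)%N])
               [set w | W (ts i.+1) w - W (ts i) w \in B i])
          = \big[*%E/1%E]_(i < n)
               P [set w | W (ts i.+1) w - W (ts i) w \in B i])
    & (forall (s t : R) (B : set R), 0 <= s -> s < t -> measurable B ->
          P [set w | W t w - W s w \in B]
          = normal_prob 0 (Num.sqrt (t - s)) B)].

(* Main.v *)
(** (i) Up to null sets both functions are controlled by the averages [d_l] of [|Delta2 f|] over
    the dyadic cells: [fD2] on the [l]-th cell is at most [d_(l-1) + d_l + d_(l+1)], and it is at
    least the contribution to [d_l] of the half cell containing the point. Since
    [Phi2 A (u / 2) <= Phi2 A u / 3], sums and maxima of two or three terms only cost a constant.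

    (ii) Put [v = 2^(-j-1)] and [m = 2^(j-k)], and let [X_l] be [2^(j/2)] times the average over
    the [l]-th cell. Cauchy-Schwarz and Jensen bound [exp (10 m (X_l / 7)^2)] by the mean over
    offsets [s] in [[0, v]] of the product of [exp (12/49 * incr^2 / v)] over the [2 m + 1]
    increments at [s + i v] met by the cell. These factors are independent, with first moment
    [7/5] and second moment [7]. After multiplication by [32^-m] the mean is at most [1/4], and,
    products over non-adjacent cells being independent, the average over the cells has variance
    [O(2^-j)]. Chebyshev's inequality and Borel-Cantelli give [orlicz <= 8] for all [k <= j] with
    [j] large; the remaining finitely many norms are finite. The integral over the offsets is
    replaced by Riemann sums on grids of [N] points. Part (iii) follows from (i) and (ii). *)

Require Import Defs.
From HB Require Import structures.
From mathcomp Require Import finmap.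
From mathcomp Require Import all_boot all_order all_algebra.
From mathcomp Require Import all_classical all_reals all_analysis.
From mathcomp Require Import measurable_realfun normal_distribution.
From mathcomp Require Import zify ring lra.
Set Implicit Arguments. Unset Strict Implicit. Unset Printing Implicit Defensive.
Import Order.TTheory GRing.Theory Num.Theory.
Import numFieldNormedType.Exports.
Local Open Scope classical_set_scope.
Local Open Scope ring_scope.

(** * Growth of the Young function: monotonicity, halving, exponential majorant *)

Section Phi.
Variable R : realType.
Implicit Types (A u v : R).

Lemma Phi2_ge0 A u : 0 <= Phi2 A u.
Proof. by rewrite /Phi2; case: ifP => // _; case: ifP => _; rewrite ?sqr_ge0 ?expR_ge0. Qed.

Lemma Phi2_le1 A u : 0 <= u <= 1 -> Phi2 A u = u ^+ 2.
Proof.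
move=> /andP[u0 u1]; rewrite /Phi2 u1; case: ifP => // u0'.
have -> : u = 0 by apply/eqP; rewrite eq_le u0 u0'.
by rewrite expr0n.
Qed.

Lemma Phi2_gt1 A u : 1 < u -> Phi2 A u = expR ((u ^+ 2 - 1) / A).
Proof. by move=> u1; rewrite /Phi2 !leNgt u1 (lt_trans _ u1). Qed.

(** Beyond 1 this is [expR y >= 1 + y] together with [(u ^ 2 - 1) / A >= u ^ 2 - 1], as [A <= 1]. It
    handles comparisons across the junction at 1. *)
Lemma sqr_le_Phi2 A u : 0 < A <= 1 -> 0 <= u -> u ^+ 2 <= Phi2 A u.
Proof.
move=> /andP[A0 A1] u0; have [u1|u1] := leP u 1; first by rewrite Phi2_le1 ?u0.
rewrite Phi2_gt1//; have u2 : 0 <= u ^+ 2 - 1 by nra.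
apply: le_trans (expR_ge1Dx _); rewrite -lerBlDl ler_pdivlMr//; nra.
Qed.

Lemma le_Phi2 A u v : 0 < A <= 1 -> 0 <= u -> u <= v -> Phi2 A u <= Phi2 A v.
Proof.
move=> A01 u0 uv; have [u1|u1] := leP u 1.
  rewrite Phi2_le1 ?u0//; apply: le_trans (sqr_le_Phi2 A01 (le_trans u0 uv)).
  by rewrite ler_sqr ?nnegrE// (le_trans u0).
have /andP[A0 A1] := A01; have v1 := lt_le_trans u1 uv.
rewrite !Phi2_gt1// ler_expR ler_pM2r ?invr_gt0// lerD2r.
by rewrite ler_sqr ?nnegrE// (le_trans u0).
Qed.

(** Up to [u = 2] the square loses a factor 4. Beyond, the two exponents differ by
    [3/4 * u ^ 2 / A >= 3], and [expR 3 >= 4]. *)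
Lemma Phi2_half A u : 0 < A <= 1 -> 0 <= u -> 3 * Phi2 A (u / 2) <= Phi2 A u.
Proof.
move=> A01 u0; have /andP[A0 A1] := A01.
have [u2|u2] := leP (u / 2) 1.
  apply: le_trans (sqr_le_Phi2 A01 u0); rewrite Phi2_le1; last lra.
  nra.
rewrite !Phi2_gt1//; last lra.
have -> : (u ^+ 2 - 1) / A = ((u / 2) ^+ 2 - 1) / A + 3 / 4 * u ^+ 2 / A.
  by field; rewrite gt_eqF.
rewrite expRD mulrC ler_wpM2l ?expR_ge0//.
apply: le_trans (expR_ge1Dx _).
have : 3 <= 3 / 4 * u ^+ 2 / A by rewrite ler_pdivlMr//; nra.
lra.
Qed.

Lemma Phi2_max A u v : Phi2 A (Num.max u v) <= Phi2 A u + Phi2 A v.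
Proof. by rewrite maxEle; case: ifP => _; rewrite ?lerDl ?lerDr Phi2_ge0. Qed.

(** As [32 <= expR 5], the last term dominates [expR (m (10 u ^ 2 - 5))]. For [u > 1] this exceeds
    [expR (m (u ^ 2 - 1))], and for [u ^ 2 >= 1/2] it is at least 1; for smaller [u] the constant
    [1/2] suffices. *)
Lemma Phi2_exp (m : nat) u : (0 < m)%N -> 0 <= u ->
  Phi2 m%:R^-1 u <= 2^-1 + 32 ^- m * expR (10 * m%:R * u ^+ 2).
Proof.
move=> m0 u0; have m1 : 1 <= m%:R :> R by rewrite ler1n.
have A01 : 0 < (m%:R^-1 : R) <= 1 by rewrite invr_gt0 ltr0n m0 invf_le1 ?ltr0n.
have e5 : 32 ^+ m <= expR (5 * m%:R) :> R.
  rewrite (_ : 5 * m%:R = 1 * (5 * m)%:R); last by rewrite natrM mul1r.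
  rewrite expRM_natr exprM; apply: lerXn2r; rewrite ?nnegrE ?exprn_ge0 ?expR_ge0//.
  rewrite (_ : 32 = 2 ^+ 5); last by ring.
  apply: lerXn2r; rewrite ?nnegrE ?expR_ge0//.
  by apply: le_trans (expR_ge1Dx 1); rewrite -[2]/(1 + 1).
have le32 (x : R) : expR (x - 5 * m%:R) <= 32 ^- m * expR x.
  rewrite expRD expRN mulrC ler_wpM2r ?expR_ge0//.
  rewrite lef_pV2 ?posrE ?expR_gt0 ?exprn_gt0//.

have [u1|u1] := leP u 1; last first.
  rewrite Phi2_gt1// -[leLHS]add0r lerD//; apply: le_trans (le32 _).
  have u2 : 1 <= u ^+ 2 by nra.
  rewrite ler_expR invrK; nra.
rewrite Phi2_le1 ?u0//; have [u2|u2] := leP (u ^+ 2) 2^-1.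
  by rewrite -[leLHS]addr0 lerD// mulr_ge0 ?invr_ge0 ?exprn_ge0 ?expR_ge0.
have : 1 <= 32 ^- m * expR (10 * m%:R * u ^+ 2).
  by apply: le_trans (le32 _); rewrite -[leLHS]expR0 ler_expR; nra.
move=> ?; nra.
Qed.

End Phi.

(** * Comparison of integrals with step sums on a grid *)

Section StepIntegral.
Variable R : realType.
Local Notation mu := (@lebesgue_measure R).

(** Both integrals are suprema over the simple functions below the integrand, so monotonicity
    extends to integrands whose measurability is unknown. *)
Lemma le_integral_ge0 d (T : measurableType d) (m : {measure set T -> \bar R})
    (D : set T) (f g : T -> \bar R) :
  (forall x, D x -> 0 <= f x)%E -> (forall x, D x -> f x <= g x)%E ->
  (\int[m]_(x in D) f x <= \int[m]_(x in D) g x)%E.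
Proof.
move=> f0 fg.
have g0 x : D x -> (0 <= g x)%E by move=> Dx; apply: le_trans (fg x Dx); exact: f0.
rewrite !ge0_integralE//; apply: ge_ereal_sup => _ [h /= hf <-].
apply: ereal_sup_ubound; exists h => // x; apply: le_trans (hf x) _.
by rewrite /patch; case: ifPn => //; rewrite inE; exact: fg.
Qed.

Lemma integral_step (I : Type) (s : seq I) (D : set R) (A : I -> set R) (c : I -> R) :
  measurable D -> (forall i, measurable (A i)) -> (forall i, 0 <= c i) ->
  (\int[mu]_(x in D) (\sum_(i <- s) c i * \1_(A i) x)%:E
   = \sum_(i <- s) (c i)%:E * mu (A i `&` D))%E.
Proof.
move=> mD mA c0.
under eq_integral do rewrite -sumEFin.
rewrite ge0_integral_sum//; last 2 first.
- move=> i; apply/measurable_EFinP; apply: measurable_funM => //.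
  by apply: measurable_indic; exact: mA.
- by move=> i x _; rewrite lee_fin mulr_ge0.
apply: eq_bigr => i _; under eq_integral do rewrite EFinM.
rewrite ge0_integralZl_EFin//.
- by rewrite integral_indic; [|exact: mD|exact: mA].
- by apply/measurable_EFinP; apply: measurable_indic; exact: mA.
Qed.

Lemma lebesgue_measure_itv_fin (b0 b1 : bool) (a b : R) : a <= b ->
  mu [set` Interval (BSide b0 a) (BSide b1 b)] = (b - a)%:E.
Proof.
move=> ab; rewrite lebesgue_measure_itv/= lte_fin; case: ltP => [_|ba].
  by rewrite -EFinB.
have -> : a = b by apply/eqP; rewrite eq_le ab ba.
by rewrite subrr.
Qed.

Variable t : nat -> R.
Hypothesis t_nd : forall i, t i <= t i.+1.

Let t_le i j : (i <= j)%N -> t i <= t j.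
Proof. by move=> ij; apply: (homo_leq lexx le_trans _ ij) => k; exact: t_nd. Qed.

Lemma itv_gap_or_point n (x : R) : t 0%N <= x <= t n ->
  (exists2 i, (i < n)%N & t i < x < t i.+1) \/ (exists2 i, (i <= n)%N & x = t i).
Proof.
elim: n => [|n IH] /andP[x0 xn].
  by right; exists 0%N => //; apply/eqP; rewrite eq_le xn x0.
have [xn'|xn'] := leP x (t n).
  have [|[i iN ix]|[i iN ix]] := IH; first by rewrite x0.
    by left; exists i => //; exact: ltnW.
  by right; exists i => //; exact: leqW.
have [-> | xS] := eqVneq x (t n.+1); first by right; exists n.+1.
by left; exists n => //; rewrite xn' lt_neqAle xS.
Qed.

Variable n : nat.

(** The bound is asked only inside the open gaps, because [D2] adds two averages at an interior grid
    point. In the dominating step function the grid points are singletons carrying the value of [g],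
    hence of measure zero. *)
Lemma integral_le_step (g : R -> R) (c : nat -> R) :
  (forall x, 0 <= g x) -> (forall i, 0 <= c i) ->
  (forall i x, (i < n)%N -> t i < x < t i.+1 -> g x <= c i) ->
  (\int[mu]_(x in `[t 0%N, t n]%classic) (g x)%:E
   <= (\sum_(i < n) c i * (t i.+1 - t i))%:E)%E.
Proof.
move=> g0 c0 gc.
pose A (k : 'I_n + 'I_n.+1) : set R :=
  match k with inl i => `]t i, t i.+1[%classic | inr i => [set t i] end.
pose C (k : 'I_n + 'I_n.+1) : R :=
  match k with inl i => c i | inr i => g (t i) end.
have C0 k : 0 <= C k by case: k => i /=.
have mA k : measurable (A k) by case: k => i /=.
pose S x := \sum_(k : 'I_n + 'I_n.+1) C k * \1_(A k) x.
have : (\int[mu]_(x in `[t 0%N, t n]%classic) (g x)%:E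
    <= \int[mu]_(x in `[t 0%N, t n]%classic) (S x)%:E)%E.
  apply: le_integral_ge0 => x /=; first by rewrite lee_fin.
  rewrite in_itv/= lee_fin /S => /itv_gap_or_point[[i iN xi]|[i iN xi]].
    rewrite (bigD1 (inl (Ordinal iN) : 'I_n + 'I_n.+1)%type)//= indicE mem_set ?mulr1/= ?in_itv//.
    by apply: ler_wpDr; [apply: sumr_ge0 => k _; rewrite mulr_ge0|exact: gc].
  rewrite (bigD1 (inr (Ordinal (iN : (i < n.+1)%N)) : 'I_n + 'I_n.+1)%type)//= indicE mem_set ?mulr1//= xi.
  by apply: ler_wpDr => //; apply: sumr_ge0 => k _; rewrite mulr_ge0.
move=> /le_trans; apply; rewrite integral_step// -sumEFin.
rewrite big_sumType/= [X in (_ + X)%E]big1 ?adde0; last first.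
  move=> i _; rewrite (_ : mu _ = 0)%E ?mule0//; apply/eqP.
  rewrite eq_le measure_ge0 andbT -(lebesgue_measure_set1 (t i)).
  by apply: le_measure; rewrite ?inE//; exact: measurableI.
apply: lee_sum => i _; rewrite EFinM lee_wpmul2l ?lee_fin//.
rewrite -(@lebesgue_measure_itv_fin false true)//.
by apply: le_measure; rewrite ?inE//; exact: measurableI.
Qed.

Lemma step_le_integral (g : R -> R) (c : nat -> R) :
  (forall x, 0 <= g x) -> (forall i, 0 <= c i) ->
  (forall i x, (i < n)%N -> t i < x < t i.+1 -> c i <= g x) ->
  ((\sum_(i < n) c i * (t i.+1 - t i))%:E
   <= \int[mu]_(x in `[t 0%N, t n]%classic) (g x)%:E)%E.
Proof.
move=> g0 c0 gc.
pose A (i : 'I_n) : set R := `]t i, t i.+1[%classic.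
have mA k : measurable (A k) by exact: measurable_itv.
pose S x := \sum_(k < n) c k * \1_(A k) x.
have : (\int[mu]_(x in `[t 0%N, t n]%classic) (S x)%:E
    <= \int[mu]_(x in `[t 0%N, t n]%classic) (g x)%:E)%E.
  apply: le_integral_ge0 => x xD; rewrite lee_fin /S.
    by apply: sumr_ge0 => k _; rewrite mulr_ge0.
  (* Off the open gaps [S] is 0; inside one of them, monotonicity of [t] excludes all the others. *)
  have [[i xi]|noi] := pselect (exists i : 'I_n, t i < x < t i.+1); last first.
    rewrite big1// => i _; rewrite indicE memNset ?mulr0// /A/= in_itv/= => xi.
    by apply: noi; exists i.
  rewrite (bigD1 i)//= big1 ?addr0.
    by rewrite indicE mem_set ?mulr1/= ?in_itv//; exact: gc.
  move=> j ji; rewrite indicE memNset ?mulr0// /A/= in_itv/= => /andP[jx xj].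
  have /andP[ix x'i] := xi.
  have [ij|ij|/val_inj ij] := ltngtP i j; last by rewrite ij eqxx in ji.
    by have := t_le ij; rewrite leNgt (lt_trans jx).
  by have := t_le ij; rewrite leNgt (lt_trans ix).
apply: le_trans; rewrite integral_step// -sumEFin.
apply: lee_sum => i _; rewrite EFinM lee_wpmul2l ?lee_fin//.
rewrite -(@lebesgue_measure_itv_fin false true)// setIidl// /A => x /=.
rewrite !in_itv/= => /andP[ix xi]; rewrite (le_trans _ (ltW ix)) ?t_le//=.
by rewrite (le_trans (ltW xi))// t_le.
Qed.

End StepIntegral.

(** * Scaling of Orlicz norms; measurability and boundedness of second differences *)

Section OrliczTransfer.
Variable R : realType.
Local Notation mu := (@lebesgue_measure R).

Lemma orlicz_le_scale (A C : R) (g g' : R -> R) : 0 < C ->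
  (forall lam : R, 0 < lam ->
    (\int[mu]_(x in @I01 R) (Phi2 A (`|g x| / lam))%:E <= 1)%E ->
    (\int[mu]_(x in @I01 R) (Phi2 A (`|g' x| / (C * lam)))%:E <= 1)%E) ->
  (orlicz A g' <= C%:E * orlicz A g)%E.
Proof.
move=> C0 H; rewrite -lee_pdivrMl//; apply: le_ereal_inf_tmp => _ [lam [lam0 hlam] <-].
rewrite lee_pdivrMl// -EFinM; apply: ereal_inf_lbound; exists (C * lam) => //.
by split; [exact: mulr_gt0|exact: H].
Qed.

(** With [f] extended by 0, the conditional becomes a polynomial expression in measurable functions
    on the whole line. *)
Lemma Delta2_patch (f : R -> R) (h x : R) :
  Delta2 f h x = (\1_(@I01 R) x * \1_(@I01 R) (x + h) * \1_(@I01 R) (x + 2 * h)) *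
    ((f \_ (@I01 R)) (x + 2 * h) - 2 * (f \_ (@I01 R)) (x + h) + (f \_ (@I01 R)) x).
Proof.
rewrite /Delta2 !indicE /patch; case: (x \in _); rewrite ?mul0r//=.
case: (x + h \in _); rewrite ?mulr0 ?mul0r//=.
by case: (x + 2 * h \in _); rewrite ?mulr0 ?mul0r//= !mul1r.
Qed.

Lemma measurable_Delta2 (f : R -> R) (h : R) : {within `[0, 1], continuous f} ->
  measurable_fun setT (Delta2 f h).
Proof.
move=> cf; rewrite (funext (Delta2_patch f h)).
have mI : measurable (@I01 R) by exact: measurable_itv.
have mf : measurable_fun setT (f \_ (@I01 R)).
  apply/(measurable_restrictT f mI).
  exact: subspace_continuous_measurable_fun.
have m1 : measurable_fun setT (\1_(@I01 R) : R -> R) by exact: measurable_indic.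
have mT c : measurable_fun setT (fun x : R => x + c) by exact: measurable_funD.
apply: measurable_funM.
  apply: measurable_funM; first apply: measurable_funM => //.
    exact: (measurableT_comp m1 (mT _)).
  exact: (measurableT_comp m1 (mT _)).
apply: measurable_funD => //; apply: measurable_funB.
  exact: (measurableT_comp mf (mT _)).
apply: measurable_funM => //; exact: (measurableT_comp mf (mT _)).
Qed.

Lemma bounded_Delta2 (f : R -> R) (h : R) : {within `[0, 1], continuous f} ->
  exists M : R, forall x, `|Delta2 f h x| <= M.
Proof.
move=> cf; have [a _ ha] := EVT_max ler01 cf; have [b _ hb] := EVT_min ler01 cf.
pose M := Num.max `|f a| `|f b|.
have fM x : x \in @I01 R -> `|f x| <= M.
  rewrite inE => xI; have := ha x xI; have := hb x xI => h1 h2.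
  rewrite ler_norml /M; apply/andP; split.
    apply: le_trans h1; by rewrite lerNl (le_trans (ler_norm _))// normrN le_max lexx orbT.
  by rewrite le_max (le_trans h2) ?ler_norm.
have M0 : 0 <= M by rewrite le_max normr_ge0.
(* Three values of size at most [M] enter with weights 1, 2, 1. *)
exists (4 * M) => x; rewrite /Delta2; case: ifPn => [/and3P[x0 x1 x2]|_]; last first.
  by rewrite normr0 mulr_ge0.
have := fM _ x0; have := fM _ x1; have := fM _ x2.
rewrite !ler_norml => /andP[? ?] /andP[? ?] /andP[? ?]; apply/andP; split; lra.
Qed.

End OrliczTransfer.

(** * Integrals of a bounded nonnegative function over intervals *)

Section BoundedIntegral.
Variable R : realType.
Local Notation mu := (@lebesgue_measure R).
Variables (g : R -> R) (M : R).
Hypotheses (mg : measurable_fun setT g) (g0 : forall x, 0 <= g x)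
  (gM : forall x, g x <= M).
Local Notation J a b := (\int[mu]_(x in `[a, b]%classic) (g x)%:E)%E.

Let mgE (D : set R) : measurable_fun D (fun x => (g x)%:E).
Proof. by apply: measurable_funTS; apply/measurable_EFinP. Qed.

Lemma integral_itv_fin a b : a <= b -> J a b \is a fin_num.
Proof.
move=> ab; pose t (i : nat) := if i is 0%N then a else b.
have t_nd i : t i <= t i.+1 by case: i => /=.
have M0 : 0 <= M := le_trans (g0 0) (gM 0).
have := @integral_le_step R t t_nd 1 g (fun=> M) g0 (fun=> M0) (fun _ x _ _ => gM x).
move=> H; rewrite ge0_fin_numE; last by apply: integral_ge0 => x _; rewrite lee_fin.
by apply: le_lt_trans H _; rewrite ltry.
Qed.

Lemma integral_itv_sub a b a' b' : a <= a' -> b' <= b -> (J a' b' <= J a b)%E.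
Proof.
move=> aa bb; apply: ge0_subset_integral; [exact: measurable_itv|exact: measurable_itv|exact: mgE|by move=> x _; rewrite lee_fin|].
by move=> x /=; rewrite !in_itv/= => /andP[? ?]; apply/andP; split; lra.
Qed.

Lemma integral_itv_cat a b c : a <= b -> b <= c -> (J a c <= J a b + J b c)%E.
Proof.
move=> ab bc.
have -> : `[a, c]%classic = `[a, b]%classic `|` `]b, c]%classic.
  apply/seteqP; split => x /=; rewrite !in_itv/=.
    move=> /andP[ax xc]; have [xb|bx] := leP x b; first by left; rewrite ax.
    by right.
  by case=> /andP[? ?]; apply/andP; split; lra.
rewrite ge0_integral_setU; [|exact: measurable_itv|exact: measurable_itv|exact: mgE| |]; last 2 first.
- by move=> x _; rewrite lee_fin.
- rewrite disj_set2E; apply/eqP/seteqP; split => x //=; rewrite !in_itv/=.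
  by move=> [/andP[_ xb] /andP[bx _]]; move: bx; rewrite ltNge xb.
apply: leeD => //; apply: ge0_subset_integral; [exact: measurable_itv|exact: measurable_itv|exact: mgE|by move=> x _; rewrite lee_fin|].
by move=> x /=; rewrite !in_itv/= => /andP[/ltW -> ->].
Qed.

End BoundedIntegral.

(** * Dyadic cell averages and the Orlicz integral of [D2] *)

Section CellAverages.
Variable R : realType.
Local Notation mu := (@lebesgue_measure R).
Implicit Types (f : R -> R) (j k l : nat) (A : R).

Definition cell_avg f j k l : R :=
  2 ^+ k * fine (DInt f j (l%:R / 2 ^+ k) (l.+1%:R / 2 ^+ k)).

Lemma DInt_ge0 f j (a b : R) : (0 <= DInt f j a b)%E.
Proof. by apply: integral_ge0 => x _; rewrite lee_fin. Qed.

Lemma cell_avg_ge0 f j k l : 0 <= cell_avg f j k l.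
Proof. by rewrite mulr_ge0 ?exprn_ge0 ?fine_ge0 ?DInt_ge0. Qed.

Lemma D2E f j k x : D2 j k f x =
  \sum_(l < 2 ^ k) \1_(`[l%:R / 2 ^+ k, l.+1%:R / 2 ^+ k]%classic) x * cell_avg f j k l.
Proof. by apply: eq_bigr => l _; rewrite /cell_avg mulrA. Qed.

Lemma D2_cell f j k l x : (l < 2 ^ k)%N -> l%:R / 2 ^+ k < x < l.+1%:R / 2 ^+ k ->
  D2 j k f x = cell_avg f j k l.
Proof.
move=> lk /andP[lx xl]; rewrite D2E (bigD1 (Ordinal lk))//= big1 ?addr0.
  by rewrite indicE mem_set ?mul1r//= in_itv/= !ltW.
move=> i /eqP il; rewrite indicE memNset ?mul0r//= in_itv/= => /andP[ix xi].
have k0 : 0 < 2 ^+ k :> R by rewrite exprn_gt0.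
apply: il; apply: val_inj => /=.
have := le_lt_trans ix xl; have := lt_le_trans lx xi.
rewrite !ltr_pM2r ?invr_gt0// !ltr_nat; lia.
Qed.

Let grid k (l : nat) : R := l%:R / 2 ^+ k.

Lemma grid_nd k l : grid k l <= grid k l.+1.
Proof. by rewrite /grid ler_pM2r ?invr_gt0 ?exprn_gt0// ler_nat. Qed.

Lemma grid_step k l : grid k l.+1 - grid k l = (2 ^+ k)^-1.
Proof. by rewrite /grid -mulrBl -natrB// subSnn mul1r. Qed.

Lemma I01_grid k : @I01 R = `[grid k 0, grid k (2 ^ k)]%classic.
Proof. by rewrite /grid /I01 mul0r natrX divff// expf_neq0. Qed.

Lemma integral_Phi2_le_grid A k (g : R -> R) (c : nat -> R) :
  (forall l, 0 <= c l) ->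
  (forall l x, (l < 2 ^ k)%N -> l%:R / 2 ^+ k < x < l.+1%:R / 2 ^+ k -> Phi2 A (g x) <= c l) ->
  (\int[mu]_(x in @I01 R) (Phi2 A (g x))%:E <= (2 ^- k * \sum_(l < 2 ^ k) c l)%:E)%E.
Proof.
move=> c0 gc; have := @integral_le_step R (grid k) (grid_nd k) (2 ^ k)
  (fun x => Phi2 A (g x)) c (fun x => Phi2_ge0 _ _) c0 gc.
rewrite -I01_grid mulrC mulr_suml; under eq_bigr do rewrite grid_step.
by [].
Qed.

Lemma grid_le_integral_Phi2 A k (g : R -> R) (c : nat -> R) :
  (forall l, 0 <= c l) ->
  (forall l x, (l < 2 ^ k)%N -> l%:R / 2 ^+ k < x < l.+1%:R / 2 ^+ k -> c l <= Phi2 A (g x)) ->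
  ((2 ^- k * \sum_(l < 2 ^ k) c l)%:E <= \int[mu]_(x in @I01 R) (Phi2 A (g x))%:E)%E.
Proof.
move=> c0 gc; have := @step_le_integral R (grid k) (grid_nd k) (2 ^ k)
  (fun x => Phi2 A (g x)) c (fun x => Phi2_ge0 _ _) c0 gc.
rewrite -I01_grid mulrC mulr_suml; under eq_bigr do rewrite grid_step.
by [].
Qed.

(** [D2] is constant inside each cell and the grid points are null, so the Orlicz condition becomes
    one on a finite mean. *)
Lemma integral_Phi2_D2 A j k f (lam : R) : 0 < lam ->
  (\int[mu]_(x in @I01 R) (Phi2 A (`|Num.sqrt (2 ^+ j) * D2 j k f x| / lam))%:E
   = (2 ^- k * \sum_(l < 2 ^ k) Phi2 A (Num.sqrt (2 ^+ j) * cell_avg f j k l / lam))%:E)%E.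
Proof.
move=> lam0; apply/eqP; rewrite eq_le; apply/andP; split.
  apply: (@integral_Phi2_le_grid A k _ (fun l => Phi2 A (Num.sqrt (2 ^+ j) * cell_avg f j k l / lam))).
    by move=> l; exact: Phi2_ge0.
  by move=> l x lk lx; rewrite (D2_cell _ _ lk lx) ger0_norm// mulr_ge0 ?cell_avg_ge0.
apply: (@grid_le_integral_Phi2 A k _ (fun l => Phi2 A (Num.sqrt (2 ^+ j) * cell_avg f j k l / lam))).
  by move=> l; exact: Phi2_ge0.
by move=> l x lk lx; rewrite (D2_cell _ _ lk lx) ger0_norm// mulr_ge0 ?cell_avg_ge0.
Qed.

(** Serves for the finitely many scales left over by Borel-Cantelli. The level [S + 1] dominates
    every scaled cell average, so each argument of [Phi2] is at most 1; the added 1 keeps the level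
    positive when [S = 0]. *)
Lemma orlicz_D2_lty (A : R) j k f : 0 < A <= 1 ->
  (orlicz A (fun x => (Num.sqrt (2 ^+ j) * D2 j k f x)%R) < +oo)%E.
Proof.
move=> A01; pose S := Num.sqrt (2 ^+ j) * (\sum_(l < 2 ^ k) cell_avg f j k l).
have S0 : 0 <= S by rewrite mulr_ge0//; apply: sumr_ge0 => l _; exact: cell_avg_ge0.
have l0 : 0 < S + 1 by rewrite ltr_wpDl.
apply: le_lt_trans (ltry (S + 1)); apply: ereal_inf_lbound; exists (S + 1) => //.
split=> //; rewrite integral_Phi2_D2// lee_fin mulrC ler_pdivrMr ?exprn_gt0// mul1r.
rewrite (_ : 2 ^+ k = \sum_(l < 2 ^ k) 1); last by rewrite sumr_const card_ord natrX.
apply: ler_sum => l _.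
have u0 : 0 <= Num.sqrt (2 ^+ j) * cell_avg f j k l / (S + 1).
  by rewrite divr_ge0 ?(ltW l0)// mulr_ge0 ?cell_avg_ge0.
have u1 : Num.sqrt (2 ^+ j) * cell_avg f j k l / (S + 1) <= 1.
  rewrite ler_pdivrMr// mul1r ler_wpDr// ler_wpM2l// (bigD1 l)//= lerDl.
  by apply: sumr_ge0 => i _; exact: cell_avg_ge0.
by rewrite Phi2_le1 ?u0// expr_le1.
Qed.

End CellAverages.

(** The cells carry the indices 1 to [n], and the entries at 0 and [n + 1] vanish; shifting the
    window by one therefore only drops a nonnegative term. *)
Lemma sum_three_shifts (R : realFieldType) (a : nat -> R) (n : nat) :
  (forall l, 0 <= a l) -> a 0%N = 0 -> a n.+1 = 0 ->
  \sum_(l < n) (a l + a l.+1 + a l.+2) / 3 <= \sum_(l < n) a l.+1.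
Proof.
move=> a0 a00 aS.
have shift (b : nat -> R) : \sum_(l < n) b l = \sum_(l < n) b l.+1 + b 0%N - b n.
  elim: n {aS} => [|m IH]; first by rewrite !big_ord0 add0r subrr.
  by rewrite !big_ord_recr/= IH; ring.
rewrite -mulr_suml !big_split/=.
have := shift a; have := shift (fun l => a l.+1); rewrite /= a00 aS.
have := a0 1%N; have := a0 n.
move: (\sum_(l < n) a l) (\sum_(l < n) a l.+1) (\sum_(l < n) a l.+2) => x y z.
by move=> *; lra.
Qed.

(** * Equivalence of the two Orlicz norms at a fixed scale *)

Section NormEquivalence.
Variable R : realType.
Local Notation mu := (@lebesgue_measure R).
Implicit Types (j k l : nat).
Variable f : R -> R.
Hypothesis cf : {within `[0, 1], continuous f}.

Let g j (x : R) := `|Delta2 f (step R j) x|.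

Let mg j : measurable_fun setT (g j).
Proof. by apply: measurableT_comp => //; exact: measurable_Delta2. Qed.

Let g_ge0 j x : 0 <= g j x. Proof. by rewrite normr_ge0. Qed.

Lemma DInt_fin j (a b : R) : a <= b -> DInt f j a b \is a fin_num.
Proof.
move=> ab; have [M gM] := bounded_Delta2 (step R j) cf.
exact: (@integral_itv_fin R (g j) M).
Qed.

Lemma DInt_sub j (a b a' b' : R) : a <= a' -> a' <= b' -> b' <= b ->
  fine (DInt f j a' b') <= fine (DInt f j a b).
Proof.
move=> aa ab bb; have ab' : a <= b by apply: le_trans bb; exact: le_trans ab.
by rewrite fine_le ?DInt_fin//; exact: (@integral_itv_sub R (g j)).
Qed.

Lemma DInt_cat j (a b c : R) : a <= b -> b <= c ->
  fine (DInt f j a c) <= fine (DInt f j a b) + fine (DInt f j b c).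
Proof.
move=> ab bc; rewrite -lee_fin EFinD !fineK ?DInt_fin// ?(le_trans ab)//.
exact: (@integral_itv_cat R (g j)).
Qed.

(** Every interior point lies outside I, where [Delta2] is 0 by definition; an endpoint that belongs
    to I is null. *)
Lemma DInt_out j (a b : R) : a <= b -> (b <= 0) || (1 <= a) -> fine (DInt f j a b) = 0.
Proof.
move=> ab out; pose t (i : nat) := if i is 0%N then a else b.
have t_nd i : t i <= t i.+1 by case: i => /=.
have out' i x : (i < 1)%N -> t i < x < t i.+1 -> g j x <= 0.
  case: i => // _ /= /andP[ax xb]; rewrite /g /Delta2.
  suff -> : x \in @I01 R = false by rewrite normr0.
  by apply/negbTE; rewrite notin_setE /I01/= in_itv/=; case/orP: out => ?; lra.
have := @integral_le_step R t t_nd 1 (g j) (fun=> 0) (g_ge0 j) (fun=> lexx 0) out'.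
rewrite big1 => [H|i _]; last by rewrite mul0r.
apply/eqP; rewrite eq_le fine_ge0 ?DInt_ge0// andbT.
by rewrite -lee_fin fineK ?DInt_fin.
Qed.

(** Cells are renumbered from 1, so that the indices 0 and [2 ^ k + 1] stand for the cells adjacent
    to I on either side, with average 0. *)
Let e j k l : R := 2 ^+ k * fine (DInt f j ((l%:R - 1) / 2 ^+ k) (l%:R / 2 ^+ k)).

Let e_ge0 j k l : 0 <= e j k l.
Proof. by rewrite mulr_ge0 ?exprn_ge0 ?fine_ge0 ?DInt_ge0. Qed.

Let eS j k l : e j k l.+1 = cell_avg f j k l.
Proof. by rewrite /e /cell_avg -[X in (X - 1) / _]natr1 addrK. Qed.

Let e0 j k : e j k 0 = 0.
Proof.
have k0 : 0 < 2 ^+ k :> R by rewrite exprn_gt0.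
rewrite /e DInt_out ?mulr0 ?mul0r ?lexx// sub0r.
Qed.

Let elast j k : e j k (2 ^ k).+1 = 0.
Proof.
have k0 : 0 < 2 ^+ k :> R by rewrite exprn_gt0.
rewrite /e DInt_out ?mulr0// -[(2 ^ k).+1%:R]natr1 ?addrK natrX ?divff ?lexx ?orbT ?gt_eqF//.
by rewrite ler_pdivlMr// mul1r lerDl.
Qed.

Lemma fD2_ge0 j k x : 0 <= fD2 j k f x.
Proof. by rewrite mulr_ge0 ?exprn_ge0 ?fine_ge0 ?DInt_ge0. Qed.

(** The window has radius half a cell, so around a point of a cell it stays within that cell and its
    two neighbours. *)
Let fD2_le j k l x : l%:R / 2 ^+ k < x < l.+1%:R / 2 ^+ k ->
  fD2 j k f x <= e j k l + e j k l.+1 + e j k l.+2.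
Proof.
move=> /andP[lx xl]; have k0 : 0 < (2 ^+ k)^-1 :> R by rewrite invr_gt0 exprn_gt0.
rewrite /e -!mulrDr ler_wpM2l ?exprn_ge0// exprS invfM.
move: lx xl; rewrite -[l.+2%:R]natr1 -[l.+1%:R]natr1 !mulrBl !mulrDl mul1r => lx xl.
set u := l%:R / 2 ^+ k in lx xl *; set q := (2 ^+ k)^-1 in k0 lx xl *.
rewrite !addrK.
apply: (@le_trans _ _ (fine (DInt f j (u - q) (u + q + q)))).
  by apply: DInt_sub; lra.
apply: (@le_trans _ _ (fine (DInt f j (u - q) (u + q)) + fine (DInt f j (u + q) (u + q + q)))).
  by apply: DInt_cat; lra.
by rewrite lerD2r; apply: DInt_cat; lra.
Qed.

(** The radius of the window equals the length of a half cell, so the window covers the half cell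
    containing [x]. The division by 2 compares the normalisations [2 ^ (k + 1)] and [2 ^ k]. *)
Let cell_avg_half_le_fD2 j k l x : l%:R / 2 ^+ k.+1 < x < l.+1%:R / 2 ^+ k.+1 ->
  cell_avg f j k.+1 l / 2 <= fD2 j k f x.
Proof.
move=> /andP[lx xl]; have k0 : 0 < (2 ^+ k.+1)^-1 :> R by rewrite invr_gt0 exprn_gt0.
rewrite /cell_avg /fD2; set D := fine _.
rewrite (_ : _ / 2 = 2 ^+ k * D); last by rewrite exprS; field.
rewrite /D ler_wpM2l ?exprn_ge0//.
move: lx xl; rewrite -[l.+1%:R]natr1 !mulrDl mul1r => lx xl.
by apply: DInt_sub; lra.
Qed.

Let cell_avg_split j k l :
  cell_avg f j k l <= (cell_avg f j k.+1 l.*2 + cell_avg f j k.+1 l.*2.+1) / 2.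
Proof.
have k0 : 0 < (2 ^+ k)^-1 :> R by rewrite invr_gt0 exprn_gt0.
have E i : i.*2%:R / 2 ^+ k.+1 = i%:R / 2 ^+ k :> R.
  by rewrite -muln2 natrM exprS invfM mulrA mulfK ?pnatr_eq0.
rewrite /cell_avg -doubleS !E; set D := fine _; set D1 := fine _; set D2 := fine _.
rewrite (_ : _ / 2 = 2 ^+ k * (D1 + D2)); last by rewrite exprS; field.
rewrite ler_wpM2l ?exprn_ge0// /D /D1 /D2.
have H : l.*2.+1%:R / 2 ^+ k.+1 = l%:R / 2 ^+ k + (2 ^+ k)^-1 / 2 :> R.
  by rewrite -[l.*2.+1%:R]natr1 mulrDl E mul1r exprS invfM [2^-1 * _]mulrC.
have H' : l.+1%:R / 2 ^+ k = l%:R / 2 ^+ k + (2 ^+ k)^-1 :> R.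
  by rewrite -[l.+1%:R]natr1 mulrDl mul1r.
by apply: DInt_cat; rewrite H ?H'; lra.
Qed.

(** The constant 6 is 3 times 2: [fD2] is at most three times the largest of three neighbouring
    averages, and halving the argument of [Phi2] gains the factor [1/3] that pays for replacing the
    maximum by a sum in [sum_three_shifts]. *)
Lemma orlicz_fD2_le (A : R) j k : 0 < A <= 1 ->
  (orlicz A (fun x => (Num.sqrt (2 ^+ j) * fD2 j k f x)%R)
   <= 6%:E * orlicz A (fun x => (Num.sqrt (2 ^+ j) * D2 j k f x)%R))%E.
Proof.
move=> A01; apply: orlicz_le_scale => // lam lam0; rewrite integral_Phi2_D2//.
set s := Num.sqrt _; have s0 : 0 <= s by exact: sqrtr_ge0.
have k0 : 0 < 2 ^- k :> R by rewrite invr_gt0 exprn_gt0.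
pose psi l := Phi2 A (s * e j k l / lam).
have psi0 l : 0 <= psi l by exact: Phi2_ge0.
have psi_out l : e j k l = 0 -> psi l = 0.
  by rewrite /psi => ->; rewrite mulr0 mul0r Phi2_le1 ?lexx ?ler01// expr0n.
under eq_bigr do rewrite -eS.
rewrite -[X in (X <= _)%E -> _]/((2 ^- k * \sum_(l < 2 ^ k) psi l.+1)%:E) lee_fin => Hle.
pose c l := (psi l + psi l.+1 + psi l.+2) / 3.
apply: (@le_trans _ _ (2 ^- k * \sum_(l < 2 ^ k) c l)%:E).
  apply: integral_Phi2_le_grid => [l|l x lk lx].
    by rewrite divr_ge0// !addr_ge0.
  have sf0 : 0 <= s * fD2 j k f x := mulr_ge0 s0 (fD2_ge0 j k x).
  rewrite ger0_norm//.
  set m := Num.max (e j k l) (Num.max (e j k l.+1) (e j k l.+2)).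
  have m0 : 0 <= m by rewrite le_max e_ge0.
  have sm0 : 0 <= s * m / lam by rewrite divr_ge0 ?mulr_ge0// ltW.
  have fm : fD2 j k f x <= 3 * m.
    apply: le_trans (fD2_le j lx) _.
    have h1 : e j k l <= m by rewrite le_max lexx.
    have h2 : e j k l.+1 <= m by rewrite !le_max lexx orbT.
    have h3 : e j k l.+2 <= m by rewrite !le_max lexx !orbT.
    lra.
  apply: (@le_trans _ _ (Phi2 A (s * m / lam / 2))).
    apply: le_Phi2 => //.
      by rewrite divr_ge0// mulr_ge0// ltW.
    rewrite (_ : s * m / lam / 2 = s * (3 * m) / (6 * lam)); last by field; rewrite gt_eqF.
    by rewrite ler_pM2r ?invr_gt0 ?mulr_gt0// ler_wpM2l.
  rewrite /c ler_pdivlMr// mulrC; apply: le_trans (Phi2_half A01 sm0) _.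
  have mon a b : 0 <= a -> 0 <= b ->
      Phi2 A (s * Num.max a b / lam) <= Phi2 A (s * a / lam) + Phi2 A (s * b / lam).
    move=> a0 b0; rewrite maxr_pMr// maxr_pMl; last by rewrite invr_ge0 ltW.
    exact: Phi2_max.
  rewrite /m -addrA; apply: le_trans (mon _ _ _ _) _ => //; first by rewrite le_max e_ge0.
  by rewrite lerD2l; apply: mon.
rewrite lee_fin; apply: le_trans Hle; rewrite ler_pM2l//.
exact: (sum_three_shifts psi0 (psi_out 0 (e0 _ _)) (psi_out _ (elast _ _))).
Qed.

(** The constant 4 is 2 times 2: [fD2] controls only half of a half-cell average, and halving the
    argument of [Phi2] gains [1/3], more than the [1/2] lost in passing from [2 ^ k] cells to
    [2 ^ (k + 1)] half cells. *)
Lemma orlicz_D2_le (A : R) j k : 0 < A <= 1 ->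
  (orlicz A (fun x => (Num.sqrt (2 ^+ j) * D2 j k f x)%R)
   <= 4%:E * orlicz A (fun x => (Num.sqrt (2 ^+ j) * fD2 j k f x)%R))%E.
Proof.
move=> A01; apply: orlicz_le_scale => // lam lam0 Hle.
rewrite integral_Phi2_D2; last by rewrite mulr_gt0.
move: Hle; set s := Num.sqrt _ => Hle; have s0 : 0 <= s by exact: sqrtr_ge0.
have k0 : 0 < 2 ^- k :> R by rewrite invr_gt0 exprn_gt0.
pose c l := Phi2 A (s * (cell_avg f j k.+1 l / 2) / lam).
have : ((2 ^- k.+1 * \sum_(l < 2 ^ k.+1) c l)%:E <= 1)%E.
  apply: le_trans Hle; apply: grid_le_integral_Phi2 => [l|l x lk lx]; first exact: Phi2_ge0.
  apply: le_Phi2 => //.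
    by rewrite divr_ge0 ?(ltW lam0)// mulr_ge0// divr_ge0 ?cell_avg_ge0.
  rewrite ger0_norm ?(mulr_ge0 s0 (fD2_ge0 j k x))// ler_pM2r ?invr_gt0// ler_wpM2l//.
  exact: cell_avg_half_le_fD2.
rewrite !lee_fin => Hc; apply: le_trans Hc.
have -> : \sum_(l < 2 ^ k.+1) c l = \sum_(l < 2 ^ k) (c l.*2 + c l.*2.+1).
  rewrite expnS mul2n; elim: (2 ^ k)%N => [|n IH]; first by rewrite !big_ord0.
  by rewrite doubleS !big_ord_recr/= IH addrA.
rewrite (_ : 2 ^- k.+1 = 2 ^- k / 2 :> R); last by rewrite exprS invfM mulrC.
rewrite -mulrA ler_pM2l// mulr_sumr; apply: ler_sum => l _.
set a := cell_avg f j k.+1 l.*2; set b := cell_avg f j k.+1 l.*2.+1.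
have u0 : 0 <= s * Num.max a b / lam / 2.
  by rewrite !divr_ge0 ?(ltW lam0)// mulr_ge0// le_max cell_avg_ge0.
apply: (@le_trans _ _ (Phi2 A (s * Num.max a b / lam / 2 / 2))).
  apply: le_Phi2 => //.
    by rewrite divr_ge0 ?(mulr_ge0 s0 (cell_avg_ge0 f j k l))// mulr_ge0// ltW.
  rewrite (_ : _ / 2 / 2 = s * Num.max a b / (4 * lam)); last by field; rewrite gt_eqF.
  rewrite ler_pM2r ?invr_gt0 ?mulr_gt0// ler_wpM2l//.
  apply: le_trans (cell_avg_split j k l) _.
  have h1 : a <= Num.max a b by rewrite le_max lexx.
  have h2 : b <= Num.max a b by rewrite le_max lexx orbT.
  rewrite -/a -/b; lra.
have H3 := Phi2_half A01 u0.
have Hm : Phi2 A (s * Num.max a b / lam / 2) <= c l.*2 + c l.*2.+1.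
  rewrite (_ : s * Num.max a b / lam / 2 = Num.max (s * (a / 2) / lam) (s * (b / 2) / lam)).
    exact: Phi2_max.
  rewrite maxr_pMr// maxr_pMl ?invr_ge0 ?(ltW lam0)// maxr_pMl ?invr_ge0//.
  by congr Num.max; field; rewrite gt_eqF.
have halve (x y z t : R) : 3 * x <= y -> y <= z + t -> 0 <= y -> x <= 2^-1 * (z + t) by lra.
exact: halve H3 Hm (Phi2_ge0 _ _).
Qed.

End NormEquivalence.

(** * Suprema over all scales *)

Section NormComparison.
Variable R : realType.

Lemma orlicz_scale_param (j k : nat) : (k <= j)%N -> 0 < (2 ^+ k / 2 ^+ j : R) <= 1.
Proof.
move=> kj; rewrite divr_gt0 ?exprn_gt0//= ler_pdivrMr ?exprn_gt0// mul1r.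
by rewrite ler_eXn2l// ltr1n.
Qed.

Lemma normfD_le (f : R -> R) : {within `[0, 1], continuous f} ->
  (normfD f <= 6%:E * normD f)%E.
Proof.
move=> cf; apply: ge_ereal_sup => _ [[j k] /= kj <-].
apply: le_trans (orlicz_fD2_le cf _ _ (orlicz_scale_param kj)) _.
by rewrite lee_wpmul2l ?lee_fin//; apply: ereal_sup_ubound; exists (j, k).
Qed.

Lemma normD_le (f : R -> R) : {within `[0, 1], continuous f} ->
  (normD f <= 4%:E * normfD f)%E.
Proof.
move=> cf; apply: ge_ereal_sup => _ [[j k] /= kj <-].
apply: le_trans (orlicz_D2_le cf _ _ (orlicz_scale_param kj)) _.
by rewrite lee_wpmul2l ?lee_fin//; apply: ereal_sup_ubound; exists (j, k).
Qed.

End NormComparison.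

(** * Expectations of products of independent factors *)

Section ProductExpectation.
Context d (T : measurableType d) (R : realType) (P : {measure set T -> \bar R}).
Local Open Scope ereal_scope.
Import HBNNSimple.

Lemma measurable_indic_comp (X : T -> R) (B : set R) :
  measurable_fun setT X -> measurable B ->
  measurable_fun setT (fun w => \1_B (X w) : R).
Proof.
move=> mX mB; rewrite (_ : (fun w => _) = \1_(X @^-1` B)).
  by apply: measurable_indic; rewrite -[X @^-1` _]setTI; exact: mX.
by apply/funext => w; rewrite !indicE.
Qed.

(** Splitting [h] over its level sets reduces identities for simple functions to identities for
    indicators. *)
Lemma integral_nnsfun_comp_mul (X H : T -> R) (h : {nnsfun R >-> R}) :
  measurable_fun setT X -> measurable_fun setT H -> (forall w, (0 <= H w)%R) ->
  let s := fset_set (range h) in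
  \int[P]_w (h (X w) * H w)%:E
  = \sum_(i < #|` s|) (s`_i)%:E * \int[P]_w (\1_(h @^-1` [set s`_i]) (X w) * H w)%:E.
Proof.
move=> mX mH H0 s.
have s0 (i : 'I_#|` s|) : (0 <= s`_i)%R.
  have : s`_i \in s by apply: mem_nth; exact: ltn_ord.
  by rewrite in_fset_set//= inE => -[x _ <-]; exact: fun_ge0.
have mi (i : 'I_#|` s|) :
    measurable_fun setT (fun w => (\1_(h @^-1` [set s`_i]) (X w) * H w)%:E).
  apply/measurable_EFinP; apply: measurable_funM => //.
  by apply: measurable_indic_comp => //; exact: measurable_funPTI.
under eq_integral do rewrite fimfunEord mulr_suml -sumEFin.
rewrite ge0_integral_sum//; last 2 first.
- move=> i; under eq_fun do rewrite -mulrA EFinM.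
  exact: measurable_funeM.
- by move=> i w _; rewrite lee_fin !mulr_ge0// s0.
apply: eq_bigr => i _; under eq_integral do rewrite -mulrA EFinM.
rewrite ge0_integralZl_EFin//.
by move=> w _; rewrite lee_fin mulr_ge0.
Qed.

Lemma cvg_integral_nnsfun_comp_mul (X H : T -> R) (phi : R -> R) (s : {nnsfun R >-> R}^nat) :
  measurable_fun setT X -> measurable_fun setT H -> (forall w, (0 <= H w)%R) ->
  (forall x, (s n x)%:E @[n --> \oo] --> (phi x)%:E) ->
  nondecreasing_seq (s : (R -> R)^nat) ->
  \int[P]_w (s n (X w) * H w)%:E @[n --> \oo] --> \int[P]_w (phi (X w) * H w)%:E.
Proof.
move=> mX mH H0 cv nd.
have -> : \int[P]_w (phi (X w) * H w)%:E = \int[P]_w (limn (fun n => (s n (X w) * H w)%:E)).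
  apply: eq_integral => w _; apply/esym/cvg_lim => //.
  under eq_fun do rewrite EFinM.
  by rewrite EFinM; apply: cvgeZr.
apply: cvg_monotone_convergence => //.
- move=> n; apply/measurable_EFinP; apply: measurable_funM => //.
  by apply: (measurableT_comp (f := s n)).
- by move=> n w _; rewrite lee_fin mulr_ge0.
- move=> w _ m n mn; rewrite lee_fin ler_wpM2r//.
  by have /lefP := nd _ _ mn.
Qed.

End ProductExpectation.

Section EqIntegral.
Import HBNNSimple.

(* Both sides are limits of their values on the same simple functions. *)
Lemma eq_integral_of_indic d1 d2 (T1 : measurableType d1) (T2 : measurableType d2)
    (R : realType) (P1 : {measure set T1 -> \bar R}) (P2 : {measure set T2 -> \bar R})
    (X1 H1 : T1 -> R) (X2 H2 : T2 -> R) :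
  measurable_fun setT X1 -> measurable_fun setT H1 -> (forall w, 0 <= H1 w) ->
  measurable_fun setT X2 -> measurable_fun setT H2 -> (forall w, 0 <= H2 w) ->
  (forall B : set R, measurable B ->
     \int[P1]_w (\1_B (X1 w) * H1 w)%:E = \int[P2]_w (\1_B (X2 w) * H2 w)%:E)%E ->
  forall phi : R -> R, measurable_fun setT phi -> (forall x, 0 <= phi x) ->
  (\int[P1]_w (phi (X1 w) * H1 w)%:E = \int[P2]_w (phi (X2 w) * H2 w)%:E)%E.
Proof.
move=> mX1 mH1 H10 mX2 mH2 H20 hB phi mphi phi0.
have mE : measurable_fun setT (EFin \o phi) by apply/measurable_EFinP.
pose s := nnsfun_approx measurableT mE.
have cv x : (s n x)%:E @[n --> \oo] --> (phi x)%:E.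
  by apply: (cvg_nnsfun_approx measurableT mE) => // y _; rewrite lee_fin.
have nd := nd_nnsfun_approx measurableT mE.
have simple n : (\int[P1]_w (s n (X1 w) * H1 w)%:E = \int[P2]_w (s n (X2 w) * H2 w)%:E)%E.
  rewrite !integral_nnsfun_comp_mul//; apply: eq_bigr => i _.
  by rewrite hB//; exact: measurable_funPTI.
have L1 := @cvg_integral_nnsfun_comp_mul _ _ _ P1 X1 H1 phi s mX1 mH1 H10 cv nd.
have L2 := @cvg_integral_nnsfun_comp_mul _ _ _ P2 X2 H2 phi s mX2 mH2 H20 cv nd.
by rewrite (funext simple) in L1; exact: (cvg_unique _ L1 L2).
Qed.

End EqIntegral.

Section IndependentProduct.
Context d (T : measurableType d) (R : realType) (P : probability T R).
Variables (n : nat) (X : nat -> T -> R).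
Hypothesis mX : forall i, (i < n)%N -> measurable_fun setT (X i).
Hypothesis indep : forall B : nat -> set R, (forall i, (i < n)%N -> measurable (B i)) ->
  P (\bigcap_(i in [set i | (i < n)%N]) (X i @^-1` B i))
  = \big[*%E/1%E]_(i < n) P (X i @^-1` B i).

Let integral_indic_comp i (B : set R) : (i < n)%N -> measurable B ->
  (\int[P]_w (\1_B (X i w))%:E = P (X i @^-1` B))%E.
Proof.
move=> iN mB; rewrite (_ : (fun w => _) = (fun w => (\1_(X i @^-1` B) w)%:E)).
  by rewrite integral_indic ?setIT// -[X i @^-1` _]setTI; exact: mX.
by apply/funext => w; rewrite !indicE.
Qed.

Let indep_indic (B : nat -> set R) : (forall i, (i < n)%N -> measurable (B i)) ->
  (\int[P]_w (\prod_(i < n) \1_(B i) (X i w))%:E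
   = (\prod_(i < n) fine (P (X i @^-1` B i)))%:E)%E.
Proof.
move=> mB; have mXB i : (i < n)%N -> measurable (X i @^-1` B i).
  by move=> iN; rewrite -[X i @^-1` _]setTI; apply: mX => //; exact: mB.
have -> : (fun w => (\prod_(i < n) (\1_(B i) (X i w) : R))%:E)
    = (fun w => (\1_(\bigcap_(i in [set i | (i < n)%N]) (X i @^-1` B i)) w)%:E).
  apply/funext => w; congr EFin; rewrite indicE.
  case: (boolP (w \in _)) => [|]; rewrite ?inE ?notin_setE => hw.
    by rewrite big1// => i _; rewrite indicE mem_set//; apply: hw => /=; exact: ltn_ord.
  have [i [iN hi]] : exists i, (i < n)%N /\ ~ B i (X i w).
    apply: contrapT => hn; apply: hw => i /= iN; apply: contrapT => hi.
    by apply: hn; exists i.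
  by rewrite (bigD1 (Ordinal iN))//= indicE memNset// mul0r.
rewrite integral_indic//; last first.
  apply: bigcap_measurableType => i /= iN.
  exact: mXB.
rewrite setIT; transitivity (P (\bigcap_(i in [set i | (i < n)%N]) (X i @^-1` B i))) => //.
rewrite (indep mB).
rewrite (eq_bigr (fun i : 'I_n => (fine (P (X i @^-1` B i)))%:E)).
  by rewrite (big_morph EFin (@EFinM R) (erefl _)).
by move=> i _; rewrite fineK// fin_num_measure//; exact: mXB.
Qed.

(** The factors are freed one at a time, by induction on [r]: those of index at least [r] are still
    indicators. For [r = 0] the claim is the independence hypothesis. *)
Lemma integral_prod_indep (phi : nat -> R -> R) (m : nat -> R) :
  (forall i, (i < n)%N -> measurable_fun setT (phi i)) ->
  (forall i x, 0 <= phi i x) ->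
  (forall i, (i < n)%N -> (\int[P]_w (phi i (X i w))%:E = (m i)%:E)%E) ->
  (\int[P]_w (\prod_(i < n) phi i (X i w))%:E = (\prod_(i < n) m i)%:E)%E.
Proof.
suff H r : forall (phi : nat -> R -> R) (m : nat -> R),
  (forall i, (i < n)%N -> measurable_fun setT (phi i)) ->
  (forall i x, 0 <= phi i x) ->
  (forall i, (i < n)%N -> (\int[P]_w (phi i (X i w))%:E = (m i)%:E)%E) ->
  (forall i, (r <= i < n)%N -> exists2 B : set R, measurable B & phi i = \1_B) ->
  (\int[P]_w (\prod_(i < n) phi i (X i w))%:E = (\prod_(i < n) m i)%:E)%E.
  by move=> h1 h2 h3; apply: (H n) => // i; lia.
elim: r => [|r IH] {}phi {}m mphi phi0 mE phiB.
  have /choice[B HB] : forall i, exists B : set R,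
      (i < n)%N -> measurable B /\ phi i = \1_B.
    move=> i; case: (ltnP i n) => [iN|]; last by exists set0.
    by have [B mB ->] := phiB i iN; exists B.
  have E i : (i < n)%N -> m i = fine (P (X i @^-1` B i)).
    move=> iN; have [mB pB] := HB i iN.
    have /(congr1 fine)/= <- := mE i iN; congr fine; rewrite pB.
    exact: integral_indic_comp.
  have mB i : (i < n)%N -> measurable (B i) by move=> iN; have [] := HB i iN.
  transitivity (\int[P]_w (\prod_(i < n) \1_(B i) (X i w))%:E)%E.
    apply: eq_integral => w _; congr EFin; apply: eq_bigr => i _.
    by have [_ ->] := HB i (ltn_ord i).
  by rewrite indep_indic//; congr EFin; apply: eq_bigr => i _; rewrite E.
have [rn|nr] := ltnP r n; last by apply: IH => // i; lia.
pose H w := \prod_(i < n | i != Ordinal rn) phi i (X i w).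
pose c := \prod_(i < n | i != Ordinal rn) m i.
have m0 i : (i < n)%N -> 0 <= m i.
  by move=> iN; rewrite -lee_fin -mE//; apply: integral_ge0 => w _; rewrite lee_fin.
have mc i : (i < n)%N -> measurable_fun setT (phi i \o X i).
  by move=> iN; apply: measurableT_comp; [exact: mphi|exact: mX].
have mH : measurable_fun setT H.
  rewrite (_ : H = fun w => \prod_(i < n) (if i == Ordinal rn then 1 else phi i (X i w))).
    apply: measurable_prod => i _; case: (i == _) => //; exact: mc (ltn_ord i).
  by apply/funext => w; rewrite /H big_mkcond/=; apply: eq_bigr => i _; case: eqP.
rewrite (eq_integral (fun w => (phi r (X r w) * H w)%:E)); last first.
  by move=> w _; rewrite (bigD1 (Ordinal rn)).
rewrite (bigD1 (Ordinal rn))//= EFinM -mE// -/c.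
have c0 : 0 <= c by apply: prodr_ge0 => i _; exact: m0.
have constZ (G : T -> R) : measurable_fun setT G -> (forall w, 0 <= G w) ->
    (\int[P]_w (G w * c)%:E = (\int[P]_w (G w)%:E) * c%:E)%E.
  move=> mG G0; under eq_integral do rewrite EFinM.
  by rewrite ge0_integralZr//; [apply/measurable_EFinP|move=> w _; rewrite lee_fin].
(* With the mean of the other factors as a constant weight, both sides integrate [phi r] of [X r]
   against a weight. It remains to treat an indicator in place of [phi r], which is the induction
   hypothesis. *)
rewrite -constZ//; last exact: mc.
apply: (@eq_integral_of_indic _ _ _ _ _ P P (X r) H (X r) (fun=> c)) => //.
- exact: mX.
- by move=> w; apply: prodr_ge0.
- exact: mX.
- move=> B mB; pose phi' i : R -> R := if i == r then \1_B else phi i.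
  have mXB : measurable (X r @^-1` B) by rewrite -[X r @^-1` _]setTI; exact: mX.
  pose m' i := if i == r then fine (P (X r @^-1` B)) else m i.
  rewrite constZ//; last by apply: measurable_indic_comp => //; exact: mX.
  rewrite integral_indic_comp//.
  have /(_ phi' m') := IH.
  rewrite (bigD1 (Ordinal rn))//= /m' eqxx.
  rewrite (eq_bigr (fun i : 'I_n => m i)); last first.
    by move=> i ir; rewrite ifN.
  rewrite EFinM fineK ?fin_num_measure// => <-.
  + apply: eq_integral => w _; rewrite (bigD1 (Ordinal rn))//= /phi' eqxx.
    by congr (_ * _)%:E; apply: eq_bigr => i ir; rewrite ifN.
  + by move=> i iN; rewrite /phi'; case: ifP => _; [exact: measurable_indic|exact: mphi].
  + by move=> i x; rewrite /phi'; case: ifP => // _; exact: phi0.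
  + move=> i iN; rewrite /phi'; case: eqP => [->|_]; last exact: mE.
    by rewrite fineK ?fin_num_measure//; exact: integral_indic_comp.
  + move=> i iN; rewrite /phi'; case: eqP => [_|ir]; first by exists B.
    by apply: phiB; lia.
- exact: mphi.
Qed.

End IndependentProduct.

(** * Exponential moments of the square of a Gaussian variable *)

Section GaussianSquareExp.
Context d (T : measurableType d) (R : realType) (P : probability T R).

(** The weight lowers the coefficient [1 / (2 s ^ 2)] in the exponent to [1 / (2 (q s) ^ 2)], and
    [q] is the ratio of the two peaks. *)
Lemma normal_pdf_sqr_exp (s q x : R) : 0 < s -> 0 < q ->
  expR ((1 - q ^- 2) / 2 * (x ^+ 2 / s ^+ 2)) * normal_pdf 0 s x
  = q * normal_pdf 0 (q * s) x.
Proof.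
move=> s0 q0; rewrite !normal_pdfE ?mulf_neq0 ?gt_eqF// /normal_peak /normal_fun subr0.
have -> : Num.sqrt ((q * s) ^+ 2 * pi *+ 2) = q * Num.sqrt (s ^+ 2 * pi *+ 2).
  rewrite exprMn -mulrA -mulrnAr sqrtrM ?sqr_ge0// sqrtr_sqr ger0_norm//; exact: ltW.
have n0 : 0 < Num.sqrt (s ^+ 2 * pi *+ 2).
  by rewrite sqrtr_gt0 pmulrn_rgt0// mulr_gt0 ?pi_gt0// exprn_gt0.
have cancel y : q * ((q * Num.sqrt (s ^+ 2 * pi *+ 2))^-1 * y)
    = (Num.sqrt (s ^+ 2 * pi *+ 2))^-1 * y by field; rewrite !gt_eqF.
rewrite cancel mulrCA -expRD.
congr (_ * expR _); field; rewrite !gt_eqF//.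
Qed.

(** The usual value [(1 - 2 a) ^ (-1/2)] for the exponent [a X ^ 2 / v], parametrised by the value
    [q] itself, so that rational [q] give rational moments. *)
Lemma integral_normal_sqr_exp (X : T -> R) (v q : R) : 0 < v -> 1 <= q ->
  measurable_fun setT X ->
  (forall B, measurable B -> P (X @^-1` B) = normal_prob 0 (Num.sqrt v) B) ->
  (\int[P]_w (expR ((1 - q ^- 2) / 2 * (X w ^+ 2 / v)))%:E = q%:E)%E.
Proof.
move=> v0 q1 mX hX; have q0 : 0 < q by apply: lt_le_trans q1.
pose s := Num.sqrt v; have s0 : 0 < s by rewrite sqrtr_gt0.
have vs : v = s ^+ 2 by rewrite sqr_sqrtr// ltW.
pose phi (x : R) := expR ((1 - q ^- 2) / 2 * (x ^+ 2 / v)).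
have mphi : measurable_fun setT phi.
  apply: measurableT_comp => //; apply: measurable_funM => //.
  by apply: measurable_funM => //; exact: measurable_funX.
have mpdf := @measurable_normal_pdf R 0 s.
transitivity (\int[P]_w (phi (X w) * 1)%:E)%E.
  by apply: eq_integral => w _; rewrite mulr1.
transitivity (\int[lebesgue_measure]_x (phi x * normal_pdf 0 s x)%:E)%E; last first.
  transitivity (\int[lebesgue_measure]_x (q%:E * (normal_pdf 0 (q * s) x)%:E))%E.
    by apply: eq_integral => x _; rewrite /phi vs normal_pdf_sqr_exp.
  rewrite ge0_integralZl_EFin ?(ltW q0)//.
  - by rewrite integral_normal_pdf mule1.
  - by move=> x _; rewrite lee_fin normal_pdf_ge0.
  - by apply/measurable_EFinP; exact: measurable_normal_pdf.
apply: (@eq_integral_of_indic _ _ _ _ _ P lebesgue_measure X (fun=> 1) id (normal_pdf 0 s)) => //.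
- by move=> x; exact: normal_pdf_ge0.
- move=> B mB; transitivity (P (X @^-1` B)).
    rewrite (_ : (fun w => _) = (fun w => (\1_(X @^-1` B) w)%:E)).
      by rewrite integral_indic ?setIT// -[X @^-1` _]setTI; exact: mX.
    by apply/funext => w; rewrite mulr1 !indicE.
  rewrite hX// /normal_prob [LHS]integral_mkcond.
  congr integral; apply/funext => x.
  by rewrite /patch indicE; case: (x \in B); rewrite ?mul1r ?mul0r.
- by move=> x; exact: expR_ge0.
Qed.

End GaussianSquareExp.

(** * First and second moments of averages over blocks of increments *)

Lemma prod_if_itv (R : comNzRingType) (c : R) (u v n : nat) : (u <= v <= n)%N ->
  \prod_(i < n) (if (u <= i < v)%N then c else 1) = c ^+ (v - u).
Proof.
move=> /andP[uv vn]; rewrite -big_mkcond/=.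
rewrite (eq_bigl (fun i : 'I_n => (i < v)%N && (u <= i)%N)); last by move=> i; rewrite andbC.
rewrite -(big_geq_mkord _ _ (fun i => (i < v)%N) (fun=> c)).
by rewrite -(big_nat_widen u v n xpredT (fun=> c))// prodr_const_nat.
Qed.

Lemma sum_eq_le1 (R : numDomainType) (L c : nat) : \sum_(l < L) ((l == c :> nat)%:R : R) <= 1.
Proof.
have [cL|Lc] := ltnP c L.
  rewrite (bigD1 (Ordinal cL))//= eqxx big1 ?addr0// => i ic.
  by rewrite (_ : (i == c :> nat) = false)//; exact/negbTE.
by rewrite big1// => i _; rewrite ltn_eqF// (leq_trans _ Lc).
Qed.

Section SecondMoment.
Context d (T : measurableType d) (R : realType) (P : probability T R).
Variables (m L : nat) (v : R) (X : nat -> T -> R).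
Hypotheses (m0 : (0 < m)%N) (L0 : (0 < L)%N) (v0 : 0 < v).
(** There are [2 m] increments per cell, and one more because a second difference started in the
    last step of I reaches beyond it. *)
Local Notation n := (2 * m * L).+1.
Hypothesis mX : forall i, (i < n)%N -> measurable_fun setT (X i).
Hypothesis indep : forall B : nat -> set R, (forall i, (i < n)%N -> measurable (B i)) ->
  P (\bigcap_(i in [set i | (i < n)%N]) (X i @^-1` B i))
  = \big[*%E/1%E]_(i < n) P (X i @^-1` B i).
Hypothesis lawX : forall i B, (i < n)%N -> measurable B ->
  P (X i @^-1` B) = normal_prob 0 (Num.sqrt v) B.

(** The number [a] counts the occurrences of an increment, so a product of two blocks is again a
    product of such factors, with [a] at most 2. *)
Definition sq_exp (v : R) (a : nat) (x : R) : R := expR (a%:R * (12 / 49 * (x ^+ 2 / v))).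

(* [integral_normal_sqr_exp] with [q = 7 / 5] and [q = 7]: there [(1 - q ^- 2) / 2] is
   [12 / 49] and [24 / 49]. *)
Definition sq_exp_mean (a : nat) : R := if a == 0%N then 1 else if a == 1%N then 7 / 5 else 7.

Lemma measurable_sq_exp (a : nat) : measurable_fun setT (sq_exp v a).
Proof.
apply: measurableT_comp => //; apply: measurable_funM => //; apply: measurable_funM => //.
by apply: measurable_funM => //; exact: measurable_funX.
Qed.

Lemma integral_sq_exp (a i : nat) : (a <= 2)%N -> (i < n)%N ->
  (\int[P]_w (sq_exp v a (X i w))%:E = (sq_exp_mean a)%:E)%E.
Proof.
move=> a2 iN; have law (q : R) (q1 : 1 <= q) := integral_normal_sqr_exp v0 q1 (mX iN)
  (fun B mB => lawX iN mB).
move: a a2 => [|[|[|//]]] _; rewrite /sq_exp /sq_exp_mean/=.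
- under eq_integral do rewrite mul0r expR0.
  by rewrite integral_cst//= mul1e; exact: probability_setT.
- have q1 : 1 <= 7 / 5 :> R by lra.
  rewrite -(law _ q1); apply: eq_integral => w _; congr (expR _)%:E.
  by rewrite mul1r; congr (_ * _); field.
- have q1 : 1 <= 7 :> R by lra.
  rewrite -(law _ q1); apply: eq_integral => w _; congr (expR _)%:E.
  by rewrite mulrA; congr (_ * _); field.
Qed.

Lemma integral_prod_sq_exp (a : nat -> nat) : (forall i, (a i <= 2)%N) ->
  (\int[P]_w (\prod_(i < n) sq_exp v (a i) (X i w))%:E
   = (\prod_(i < n) sq_exp_mean (a i))%:E)%E.
Proof.
move=> a2; apply: (integral_prod_indep mX indep (phi := fun i => sq_exp v (a i))
  (m := fun i => sq_exp_mean (a i))).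
- by move=> i _; exact: measurable_sq_exp.
- by move=> i x; exact: expR_ge0.
- by move=> i iN; exact: integral_sq_exp.
Qed.

(* Indices of the increments that occur in the second differences started in the [l]-th
   cell; two neighbouring cells share exactly one increment. *)
Definition block (m l i : nat) : nat := ((2 * m * l <= i) && (i < 2 * m * l + (2 * m).+1))%N.

Definition block_exp (l : nat) (w : T) : R := \prod_(i < n) sq_exp v (block m l i) (X i w).

Let block_le (l : nat) : (l < L)%N -> (2 * m * l + (2 * m).+1 <= n)%N.
Proof. by move=> lL; rewrite addnS ltnS -{2}[(2 * m)%N]muln1 -mulnDr addn1 leq_mul2l lL orbT. Qed.

Lemma block_exp_ge0 l w : 0 <= block_exp l w.
Proof. by apply: prodr_ge0 => i _; exact: expR_ge0. Qed.

Lemma measurable_block_exp l : measurable_fun setT (block_exp l).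
Proof.
apply: (@measurable_prod _ _ _ _ _ _ (fun (i : 'I_n) w => sq_exp v (block m l i) (X i w))) => i _.
by apply: measurableT_comp; [exact: measurable_sq_exp|exact: mX].
Qed.

Let prod_sq_exp_mean (c : nat) l : (l < L)%N -> (c <= 2)%N ->
  \prod_(i < n) sq_exp_mean (c * block m l i) = sq_exp_mean c ^+ (2 * m).+1.
Proof.
move=> lL c2; have := @prod_if_itv R (sq_exp_mean c) (2 * m * l) (2 * m * l + (2 * m).+1) n.
rewrite leq_addr block_le// addKn => <- //; apply: eq_bigr => i _.
by rewrite /block; case: ifP => _; rewrite ?muln1 ?muln0.
Qed.

Lemma integral_block_exp l : (l < L)%N ->
  (\int[P]_w (block_exp l w)%:E = ((7 / 5) ^+ (2 * m).+1)%:E)%E.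
Proof.
move=> lL; rewrite /block_exp integral_prod_sq_exp; last first.
  by move=> i; rewrite /block; case: (_ && _).
by have := @prod_sq_exp_mean 1 l lL isT; under eq_bigr do rewrite mul1n; move=> ->.
Qed.

(** Blocks at distance at least two are disjoint, and the mean factorises. For equal or adjacent
    cells, which the three indicators select, Cauchy-Schwarz bounds the mean by the second moment
    [7 ^ (2 m + 1)]. *)
Lemma integral_block_exp_mul l l' : (l < L)%N -> (l' < L)%N ->
  (\int[P]_w (block_exp l w * block_exp l' w)%:E
   <= (((7 / 5) ^+ (2 * m).+1) ^+ 2
      + 7 ^+ (2 * m).+1 * ((l' == l)%:R + (l' == l.+1)%:R + (l'.+1 == l)%:R))%:E)%E.
Proof.
move=> lL lL'.
have b1 i l0 : (block m l0 i <= 1)%N by rewrite /block; case: (_ && _).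
have -> : (\int[P]_w (block_exp l w * block_exp l' w)%:E
    = (\prod_(i < n) sq_exp_mean (block m l i + block m l' i))%:E)%E.
  rewrite -(integral_prod_sq_exp (a := fun i => block m l i + block m l' i)%N); last first.
    by move=> i; exact: (leq_add (b1 _ _) (b1 _ _)).
  apply: eq_integral => w _; congr EFin; rewrite /block_exp -big_split/=.
  by apply: eq_bigr => i _; rewrite /sq_exp -expRD -mulrDl -natrD.
have mean_gt0 a : 0 < sq_exp_mean a by rewrite /sq_exp_mean; do 2 case: ifP => _ //; lra.
rewrite lee_fin.
have [far|near] := boolP ((l.+1 < l') || (l'.+1 < l))%N.
  have -> : \prod_(i < n) sq_exp_mean (block m l i + block m l' i)
      = \prod_(i < n) sq_exp_mean (1 * block m l i) * \prod_(i < n) sq_exp_mean (1 * block m l' i).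
    rewrite -big_split/=; apply: eq_bigr => i _; rewrite !mul1n.
    have : (block m l i == 0%N) || (block m l' i == 0%N).
      apply: contraT; rewrite negb_or /block !eqb0 !negbK => /andP[/andP[h1 h2] /andP[h3 h4]].
      exfalso; case/orP: far => ll.
        have := leq_mul2l (2 * m) l.+2 l'; rewrite ll orbT !mulnS; lia.
      have := leq_mul2l (2 * m) l'.+2 l; rewrite ll orbT !mulnS; lia.
    by case/orP => /eqP ->; rewrite ?add0n ?addn0 /sq_exp_mean eqxx ?mul1r ?mulr1.
  rewrite !prod_sq_exp_mean// -expr2 lerDl mulr_ge0 ?exprn_ge0//.
(* [sq_exp_mean (a + b) ^+ 2 <= sq_exp_mean (2 * a) * sq_exp_mean (2 * b)] for [a, b <= 1]. *)
have V : \prod_(i < n) sq_exp_mean (block m l i + block m l' i) <= 7 ^+ (2 * m).+1.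
  rewrite -ler_sqr ?nnegrE ?exprn_ge0 ?prodr_ge0// => [|i _]; last exact: ltW.
  have := @prod_sq_exp_mean 2 l lL isT; have := @prod_sq_exp_mean 2 l' lL' isT.
  rewrite -[sq_exp_mean 2]/(7 : R) => E' E; rewrite [leRHS]expr2 -{1}E -E' -big_split/=.
  rewrite -prodrXl; apply: ler_prod => i _; rewrite sqr_ge0/=.
  have := b1 i l; have := b1 i l'.
  move: (block m l i) (block m l' i) => [|[|//]] [|[|//]] _ _; rewrite /sq_exp_mean/=; lra.
apply: le_trans V _; rewrite ler_wpDl ?sqr_ge0// ler_peMr ?exprn_ge0//.
have : [|| l' == l, l' == l.+1 | l'.+1 == l] by lia.
by case/or3P => ->; do ?case: (_ == _); rewrite /=; lra.
Qed.

(** The weight [32 ^- m] is that of [Phi2_exp]. *)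
Definition block_avg (w : T) : R := 32 ^- m / L%:R * \sum_(l < L) block_exp l w.

Lemma block_avg_ge0 w : 0 <= block_avg w.
Proof. by apply: mulr_ge0 => //; apply: sumr_ge0 => l _; exact: block_exp_ge0. Qed.

Lemma measurable_block_avg : measurable_fun setT block_avg.
Proof.
apply: measurable_funM => //; apply: measurable_sum => l; exact: measurable_block_exp.
Qed.

Let LR : 0 < L%:R :> R. Proof. by rewrite ltr0n. Qed.
Let w0 : 0 <= 32 ^- m / L%:R :> R. Proof. by []. Qed.
Let mbe l : measurable_fun setT (fun w => (block_exp l w)%:E).
Proof. by apply/measurable_EFinP; exact: measurable_block_exp. Qed.
Let be_ge0 l w : (0 <= (block_exp l w)%:E)%E.
Proof. by rewrite lee_fin block_exp_ge0. Qed.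

Lemma integral_block_avg :
  (\int[P]_w (block_avg w)%:E = (32 ^- m * (7 / 5) ^+ (2 * m).+1)%:E)%E.
Proof.
under eq_integral do rewrite EFinM -sumEFin.
rewrite ge0_integralZl_EFin//; last 2 first.
- by move=> w _; rewrite sume_ge0.
- exact: emeasurable_sum.
rewrite ge0_integral_sum//.
rewrite (eq_bigr (fun=> ((7 / 5) ^+ (2 * m).+1)%:E)); last first.
  by move=> l _; exact: integral_block_exp.
rewrite sumEFin sumr_const card_ord -EFinM -[X in (_ * X)]mulr_natl; congr EFin.
by rewrite mulrA divfK// gt_eqF.
Qed.

(** Each of the [L] rows of the double sum has at most three near pairs, so the excess over the
    squared mean is of order [1 / L]. *)
Lemma integral_block_avg_sqr :
  (\int[P]_w (block_avg w ^+ 2)%:E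
   <= ((32 ^- m * (7 / 5) ^+ (2 * m).+1) ^+ 2
      + 3 * (7 ^+ (2 * m).+1 * 32 ^- m ^+ 2) / L%:R)%:E)%E.
Proof.
have mbb l l' : measurable_fun setT (fun w => (block_exp l w * block_exp l' w)%:E).
  by apply/measurable_EFinP; apply: measurable_funM; exact: measurable_block_exp.
have bb0 l l' w : (0 <= (block_exp l w * block_exp l' w)%:E)%E.
  by rewrite lee_fin mulr_ge0 ?block_exp_ge0.
have E w : block_avg w ^+ 2
    = (32 ^- m / L%:R) ^+ 2 * \sum_(l < L) \sum_(l' < L) block_exp l w * block_exp l' w.
  rewrite exprMn; congr (_ * _); rewrite expr2 mulr_suml.
  by apply: eq_bigr => l _; rewrite mulr_sumr.
under eq_integral do rewrite E EFinM -sumEFin.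
under eq_integral do under eq_bigr do rewrite -sumEFin.
rewrite ge0_integralZl_EFin ?sqr_ge0//; last 2 first.
- by move=> w _; rewrite !sume_ge0// => l _; rewrite sume_ge0.
- by apply: emeasurable_sum => l; exact: emeasurable_sum.
rewrite ge0_integral_sum//; last 2 first.
- by move=> l; exact: emeasurable_sum.
- by move=> l w _; rewrite sume_ge0.
set A : R := (7 / 5) ^+ (2 * m).+1; set V : R := 7 ^+ (2 * m).+1.
have V0 : 0 <= V by rewrite exprn_ge0.
have row (l : 'I_L) : (\int[P]_w (\sum_(l' < L) (block_exp l w * block_exp l' w)%:E)
    <= (L%:R * A ^+ 2 + V * 3)%:E)%E.
  rewrite ge0_integral_sum//.
  apply: (@le_trans _ _ (\sum_(l' < L) (A ^+ 2
    + V * ((l' == l :> nat)%:R + (l' == l.+1 :> nat)%:R + (l'.+1 == l)%:R))%:E)%E).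
    by apply: lee_sum => l' _; exact: integral_block_exp_mul.
  rewrite sumEFin lee_fin big_split/= sumr_const card_ord -[X in X + _]mulr_natl lerD2l.
  rewrite -mulr_sumr ler_wpM2l// !big_split/=.
  have := sum_eq_le1 R L l; have := sum_eq_le1 R L l.+1.
  suff : \sum_(l' < L) ((l'.+1 == l)%:R : R) <= 1 by lra.
  (* For [l = 0] all terms on the left vanish, so the value [0.-1 = 0] does no harm. *)
  apply: le_trans (sum_eq_le1 R L l.-1); apply: ler_sum => l' _.
  by case: eqP => [<-|_]; rewrite ?eqxx.
apply: (@le_trans _ _ (((32 ^- m / L%:R) ^+ 2)%:E * \sum_(l < L) (L%:R * A ^+ 2 + V * 3)%:E)%E).
  by rewrite lee_wpmul2l ?lee_fin ?sqr_ge0//; apply: lee_sum => l _; exact: row.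
rewrite sumEFin sumr_const card_ord -EFinM -[X in (_ * X)]mulr_natl lee_fin.
rewrite le_eqVlt; apply/orP; left; apply/eqP; field.
by rewrite !gt_eqF// exprn_gt0.
Qed.

(** The left side is [7/5 * (49/800) ^ m], largest at [m = 1]. *)
Lemma block_avg_mean_le : 32 ^- m * (7 / 5) ^+ (2 * m).+1 <= 4^-1 :> R.
Proof.
rewrite exprS exprM mulrCA -exprVn -exprMn_comm; last exact: mulrC.
rewrite -(prednK m0) exprS.
have : (32^-1 * (7 / 5) ^+ 2) ^+ m.-1 <= 1 :> R by rewrite exprn_ile1 ?mulr_ge0//; lra.
have : 0 <= (32^-1 * (7 / 5) ^+ 2) ^+ m.-1 :> R by rewrite exprn_ge0// ?mulr_ge0.
move: (_ ^+ m.-1) => x; lra.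
Qed.

(** The left side is [7 * (49/512) ^ m / 2 ^ m], where [7 * 49/512 <= 1] and [2 ^ m >= m]. The gain
    [1 / m] turns [1 / L] into [1 / (m L)], which is [2 ^- j] in the application. *)
Lemma block_avg_var_le : 7 ^+ (2 * m).+1 * 32 ^- m ^+ 2 <= m%:R^-1 :> R.
Proof.
have mR : 0 < m%:R :> R by rewrite ltr0n.
have -> : 7 ^+ (2 * m).+1 * 32 ^- m ^+ 2 = 7 * (49 / 512) ^+ m / 2 ^+ m :> R.
  rewrite exprS -[32 ^- m]exprVn -exprM [(m * 2)%N]mulnC !exprM.
  rewrite -[2 ^- m]exprVn -!mulrA -!exprMn; congr (_ * _ ^+ _); lra.
rewrite ler_pdivrMr ?exprn_gt0//.
have H2 : 1 <= m%:R^-1 * 2 ^+ m :> R.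
  by rewrite mulrC ler_pdivlMr// mul1r -natrX ler_nat ltnW// ltn_expl.
apply: le_trans H2.
have q0 : 0 <= 49 / 512 :> R by lra.
have q1 : 49 / 512 <= 1 :> R by lra.
have q7 : 7 * (49 / 512) <= 1 :> R by lra.
move: (49 / 512) q0 q1 q7 => q q0 q1 q7.
case: m m0 => // p _; rewrite exprS mulrA mulr_ile1//; first by rewrite mulr_ge0.
  exact: exprn_ge0.
exact: exprn_ile1.
Qed.

End SecondMoment.

(** * A tail bound for averages of dependent variables *)

Lemma sqr_sum_le (R : realFieldType) (n : nat) (a : nat -> R) :
  (\sum_(i < n) a i) ^+ 2 <= n%:R * \sum_(i < n) a i ^+ 2.
Proof.
(* This is the expanded sum of the squares [(a i - c) ^ 2]; the induction below takes [c = a n]. *)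
have dev c k : 0 <= \sum_(i < k) a i ^+ 2 - 2 * c * \sum_(i < k) a i + k%:R * c ^+ 2.
  elim: k => [|k IH]; first by rewrite !big_ord0 mulr0 mul0r subr0 addr0.
  rewrite !big_ord_recr/= -natr1; have := sqr_ge0 (a k - c); nra.
elim: n => [|n IH]; first by rewrite !big_ord0 expr0n mul0r.
rewrite !big_ord_recr/= -natr1; have := dev (a n) n; nra.
Qed.

Section TailBound.
Context d (T : measurableType d) (R : realType) (P : probability T R).
Local Open Scope ereal_scope.

(** Averages for different offsets are dependent, but by convexity of the square their mean inherits
    both moment bounds. The factor 16 is [(1/4) ^- 2], the distance from [c <= 1/4] to the threshold
    [1/2] being at least [1/4]. *)
Lemma tail_average (N : nat) (Z : nat -> T -> R) (c eta : R) : (0 < N)%N ->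
  (0 <= c <= 4^-1)%R -> (forall q, measurable_fun setT (Z q)) ->
  (forall q w, 0 <= Z q w)%R ->
  (forall q, \int[P]_w (Z q w)%:E = c%:E) ->
  (forall q, \int[P]_w (Z q w ^+ 2)%:E <= (c ^+ 2 + eta)%:E) ->
  P [set w | 2^-1 < (\sum_(q < N) Z q w) / N%:R]%R <= (16 * eta)%:E.
Proof.
move=> N0 /andP[c0 c4] mZ Z0 EZ EZ2.
have NR : (0 < N%:R :> R)%R by rewrite ltr0n.
pose Q w := ((\sum_(q < N) Z q w) / N%:R)%R.
have Q0 w : (0 <= Q w)%R by rewrite divr_ge0// sumr_ge0.
have mS : measurable_fun setT (fun w => \sum_(q < N) Z q w)%R by apply: measurable_sum.
have mQ : measurable_fun setT Q by apply: measurable_funM.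
have mA : measurable [set w | 2^-1 < Q w]%R.
  rewrite (_ : [set w | _] = [set: T] `&` Q @^-1` (`]2^-1%R, +oo[%classic)%R).
    by apply: mQ => //; exact: measurable_itv.
  by rewrite setTI; apply/seteqP; split => w /=; rewrite in_itv/= andbT.
have EQ : \int[P]_w (Q w)%:E = c%:E.
  under eq_integral do rewrite /Q mulrC EFinM -sumEFin.
  rewrite ge0_integralZl_EFin//; last 2 first.
  - by move=> w _; rewrite sume_ge0// => q _; rewrite lee_fin.
  - by apply: emeasurable_sum => q; apply/measurable_EFinP.
  rewrite ge0_integral_sum//; last 2 first.
  - by move=> q; apply/measurable_EFinP.
  - by move=> q w _; rewrite lee_fin.
  rewrite (eq_bigr (fun=> c%:E))// sumEFin sumr_const card_ord -EFinM -[X in (_ * X)%R]mulr_natl.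
  by congr EFin; field; rewrite gt_eqF.
have mZ2 q : measurable_fun setT (fun w => Z q w ^+ 2)%R by apply: measurable_funX.
have EQ2 : \int[P]_w (Q w ^+ 2)%:E <= (c ^+ 2 + eta)%:E.
  apply: (@le_trans _ _ (\int[P]_w ((N%:R^-1)%:E * \sum_(q < N) (Z q w ^+ 2)%:E))).
    apply: le_integral_ge0 => w _; first by rewrite lee_fin sqr_ge0.
    rewrite sumEFin -EFinM lee_fin /Q exprMn exprVn ler_pdivrMr ?exprn_gt0//.
    have := sqr_sum_le N (fun q => Z q w); congr (_ <= _)%R.
    by field; rewrite gt_eqF.
  rewrite ge0_integralZl_EFin//; last 2 first.
  - by move=> w _; rewrite sume_ge0// => q _; rewrite lee_fin sqr_ge0.
  - by apply: emeasurable_sum => q; apply/measurable_EFinP.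
  rewrite ge0_integral_sum//; last 2 first.
  - by move=> q; apply/measurable_EFinP.
  - by move=> q w _; rewrite lee_fin sqr_ge0.
  apply: (@le_trans _ _ ((N%:R^-1)%:E * \sum_(q < N) (c ^+ 2 + eta)%:E)).
    by rewrite lee_wpmul2l ?lee_fin ?invr_ge0 ?(ltW NR)//; apply: lee_sum => q _.
  rewrite sumEFin sumr_const card_ord -EFinM lee_fin.
  by rewrite -[X in (_ * X <= _)%R]mulr_natl mulKf// gt_eqF.
have mQ2 : measurable_fun setT (fun w => Q w ^+ 2)%R by apply: measurable_funX.
(* Chebyshev without centring: [\1_{Q > 1/2} + 32 c Q <= 16 Q ^ 2 + 16 c ^ 2]. *)
have key : P [set w | 2^-1 < Q w]%R + (32 * c ^+ 2)%:E <= (16 * (c ^+ 2 + eta) + 16 * c ^+ 2)%:E.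
  have -> : P [set w | 2^-1 < Q w]%R + (32 * c ^+ 2)%:E
      = \int[P]_w ((\1_[set w | 2^-1 < Q w]%R w)%:E + (32 * c)%:E * (Q w)%:E).
    rewrite ge0_integralD//; last 3 first.
    - by apply/measurable_EFinP; exact: measurable_indic.
    - by move=> w _; rewrite -EFinM lee_fin; apply: mulr_ge0 => //; exact: mulr_ge0.
    - by apply: measurable_funeM; apply/measurable_EFinP.
    rewrite integral_indic// setIT ge0_integralZl_EFin//; last 3 first.
    - by move=> w _; rewrite lee_fin.
    - by apply/measurable_EFinP.
    - by rewrite mulr_ge0.
    by rewrite EQ -EFinM expr2 mulrA.
  apply: (@le_trans _ _ (\int[P]_w (16%:E * (Q w ^+ 2)%:E + (16 * c ^+ 2)%:E))).
    apply: le_integral_ge0 => w _.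
      by rewrite -EFinM -EFinD lee_fin addr_ge0//; apply: mulr_ge0 => //; exact: mulr_ge0.
    rewrite -!EFinM -!EFinD lee_fin indicE.
    case: (boolP (w \in _)); rewrite ?inE ?notin_setE => hw /=; have := Q0 w; last first.
      by have := sqr_ge0 (Q w - c); nra.
    by move: hw => /=; nra.
  rewrite ge0_integralD//; last 3 first.
  - by move=> w _; rewrite -EFinM lee_fin mulr_ge0// sqr_ge0.
  - by apply: measurable_funeM; apply/measurable_EFinP.
  - by move=> w _; rewrite lee_fin mulr_ge0// sqr_ge0.
  rewrite ge0_integralZl_EFin//; last 2 first.
  - by move=> w _; rewrite lee_fin sqr_ge0.
  - by apply/measurable_EFinP.
  rewrite integral_cst//= [P _]probability_setT mule1.
  by rewrite [X in _ <= X]EFinD; apply: leeD => //; rewrite EFinM lee_wpmul2l// lee_fin.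
rewrite -(leeD2rE (x := (32 * c ^+ 2)%:E))// (le_trans key)// -EFinD lee_fin; lra.
Qed.

End TailBound.

(** * Uniform continuity, regrouping of sums, and Jensen's inequality *)

Section PathBound.
Variable R : realType.

(** Compactness is used as a near-covering property, along [del] tending to 0 from the right: near
    [x], both points lie within the radius where [f] is [e / 2]-close to [f x]. *)
Lemma unif_continuous_itv (f : R -> R) (b e : R) :
  {within `[0, b], continuous f} -> 0 < e ->
  exists2 del : R, 0 < del & forall x y, x \in `[0, b] -> y \in `[0, b] ->
    `|x - y| < del -> `|f x - f y| < e.
Proof.
move=> cf e0; have cK : compact `[0, b]%classic := @segment_compact R 0 b.
have e2 : 0 < e / 2 by rewrite divr_gt0.
have /near_covering_withinP cov := (compact_near_coveringP _).1 cK.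
have := cov R (0 : R)^'+ (fun del x => forall y, y \in `[0, b] -> `|x - y| < del ->
  `|f x - f y| < e) _.
case.
  move=> x xK; have /subspace_continuousP/(_ x xK)/cvgrPdist_lt/(_ _ e2) := cf.
  rewrite near_withinE => /nbhs_ballP[r /= r0 hr].
  have r2 : 0 < r / 2 by rewrite divr_gt0.
  exists (ball x (r / 2), [set del | del < r / 2]) => /=.
    by split; [exact: nbhsx_ballx|exact: nbhs_right_lt].
  move=> [x' del] /= [xx' dr] x'K y yK yd.
  have h1 : `|f x - f x'| < e / 2.
    apply: hr => //; apply: lt_trans xx' _; lra.
  have h2 : `|f x - f y| < e / 2.
    apply: hr => //; rewrite -ball_normE /= (le_lt_trans (ler_distD x' _ _))//.
    move: xx'; rewrite -ball_normE /= => xx'; lra.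
  rewrite (le_lt_trans (ler_distD (f x) _ _))//.
  by rewrite [X in X + _]distrC; lra.
move=> r /= r0 hr; exists (r / 2); first by rewrite divr_gt0.
move=> x y xK yK xy; apply: (hr (r / 2)) => //=.
- by rewrite sub0r normrN ger0_norm ?divr_ge0 ?ltW//; lra.
- by rewrite divr_gt0.
Qed.

Lemma sum_mul_ord (V : nmodType) (M N : nat) (G : nat -> V) :
  \sum_(p < M * N) G p = \sum_(i < M) \sum_(q < N) G (i * N + q)%N.
Proof.
elim: M => [|M IH]; first by rewrite !big_ord0.
by rewrite mulSnr big_split_ord/= big_ord_recr/= IH.
Qed.

Lemma sum_if_itv (V : nmodType) (F : nat -> V) (u c n : nat) : (u + c <= n)%N ->
  \sum_(i < n) (if (u <= i < u + c)%N then F i else 0) = \sum_(i < c) F (u + i)%N.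
Proof.
move=> un; rewrite -big_mkcond/=.
rewrite (eq_bigl (fun i : 'I_n => (i < u + c)%N && (u <= i)%N)); last by move=> i; rewrite andbC.
rewrite -(big_geq_mkord _ _ (fun i => (i < u + c)%N) F).
rewrite -(big_nat_widen u (u + c) n xpredT F)// -{1}[u]add0n big_addn addKn big_mkord.
by apply: eq_bigr => i _; rewrite addnC.
Qed.

(** Jensen's inequality from the tangent at the mean: [expR x >= expR a * (1 + x - a)], and the
    linear terms sum to 0. *)
Lemma expR_mean_le (N : nat) (x : nat -> R) : (0 < N)%N ->
  expR ((\sum_(q < N) x q) / N%:R) <= (\sum_(q < N) expR (x q)) / N%:R.
Proof.
move=> N0; have NR : 0 < N%:R :> R by rewrite ltr0n.
set a := _ / _; rewrite ler_pdivlMr//.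
have -> : expR a * N%:R = \sum_(q < N) expR a * (1 + (x q - a)).
  rewrite -mulr_sumr; congr (_ * _); rewrite big_split/= big_split/= !sumr_const card_ord.
  by rewrite -[- a *+ N]mulr_natl /a; field; rewrite gt_eqF.
apply: ler_sum => q _; rewrite -{2}[x q](subrKC a) expRD ler_wpM2l ?expR_ge0//.
exact: expR_ge1Dx.
Qed.

End PathBound.

(** * Riemann sums for the cell averages of a path *)

Section PathOrlicz.
Variable R : realType.
Implicit Types (f : R -> R) (j k l N : nat).

Lemma step_gt0 j : 0 < step R j.
Proof. by rewrite invr_gt0 exprn_gt0. Qed.

Lemma step_le_half j : step R j <= 2^-1.
Proof. by rewrite lef_pV2 ?posrE ?exprn_gt0// ler_eXnr// ler1n. Qed.

(** Dropping the cutoff of [Delta2] at the right end of I treats all cells alike, at the price of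
    using the path up to time 2. *)
Definition second_diff f (s x : R) : R := f (x + 2 * s) - 2 * f (x + s) + f x.

Lemma Delta2_le f (s x : R) : `|Delta2 f s x| <= `|second_diff f s x|.
Proof. by rewrite /Delta2; case: ifP => _ //; rewrite normr0. Qed.

Let grid_width j k N : (k <= j)%N -> (0 < N)%N ->
  2 ^+ k * (step R j / N%:R) = (2 * 2 ^ (j - k) * N)%:R^-1.
Proof.
move=> kj N0; rewrite /step !natrM natrX -{1}(subnK kj) exprS exprD; field.
by rewrite !expf_neq0//= pnatr_eq0 -lt0n N0.
Qed.

(** Within a gap of width less than [del] the three values of [f], with weights 1, 2, 1, each move
    by less than [e], which gives [4 * e]. *)
Lemma cell_avg_le_riemann f (e del : R) j k l N M : M = (2 * 2 ^ (j - k) * N)%N ->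
  (k <= j)%N -> (l < 2 ^ k)%N -> (0 < N)%N ->
  (forall x y, x \in `[0, 2] -> y \in `[0, 2] -> `|x - y| < del -> `|f x - f y| < e) ->
  0 < e -> step R j / N%:R < del ->
  cell_avg f j k l <=
    (\sum_(p < M) `|second_diff f (step R j) (l%:R / 2 ^+ k + p%:R * (step R j / N%:R))|) / M%:R
    + 4 * e.
Proof.
move=> ME kj lk N0 mod_f e0 hdel.
have h0 := step_gt0 j; have h2 := step_le_half j.
set s := step R j in h0 h2 hdel *.
have NR : 0 < N%:R :> R by rewrite ltr0n.
have q0 : 0 < s / N%:R by rewrite divr_gt0.
have K0 : 0 < 2 ^+ k :> R by rewrite exprn_gt0.
have M0 : (0 < M)%N by rewrite ME !muln_gt0 expn_gt0.
have MR : 0 < M%:R :> R by rewrite ltr0n.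
have wid : 2 ^+ k * (s / N%:R) = M%:R^-1 by rewrite ME; exact: grid_width.
pose t p := l%:R / 2 ^+ k + p%:R * (s / N%:R).
have tS p : t p.+1 = t p + s / N%:R by rewrite /t -[p.+1%:R]natr1 mulrDl mul1r addrA.
have t_nd p : t p <= t p.+1 by rewrite tS lerDl ltW.
have t0 : t 0%N = l%:R / 2 ^+ k by rewrite /t mul0r addr0.
have tM : t M = l.+1%:R / 2 ^+ k.
  rewrite /t -[l.+1%:R]natr1 mulrDl mul1r; congr (_ + _).
  by apply: (mulfI (lt0r_neq0 K0)); rewrite mulrCA wid !divff// gt_eqF.
have t_le p p' : (p <= p')%N -> t p <= t p'.
  by move=> pp; apply: (homo_leq lexx le_trans _ pp) => i; exact: t_nd.
pose c p := `|second_diff f s (t p)| + 4 * e.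
have c0 p : 0 <= c p by rewrite addr_ge0// mulr_ge0// ltW.
have gc p x : (p < M)%N -> t p < x < t p.+1 -> `|Delta2 f s x| <= c p.
  move=> pM /andP[px xp]; apply: le_trans (Delta2_le _ _ _) _.
  have tp0 : 0 <= t p by rewrite (le_trans _ (t_le 0 p _))// t0 divr_ge0// ltW.
  have x1 : x <= 1.
    apply: le_trans (ltW xp) _; apply: le_trans (t_le _ _ pM) _.
    by rewrite tM ler_pdivrMr// mul1r -natrX ler_nat.
  have mod_d u : 0 <= u <= 1 -> `|f (x + u) - f (t p + u)| < e.
    move=> /andP[u0 u1]; apply: mod_f; rewrite ?in_itv/=.
    - by apply/andP; split; lra.
    - by apply/andP; split; lra.
    - rewrite (_ : _ - _ = x - t p); last by ring.
      rewrite ger0_norm; last by lra.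
      by rewrite tS in xp; lra.
  have := mod_d 0; have := mod_d s; have := mod_d (2 * s).
  rewrite /c /second_diff !addr0 lexx ler01 => /(_ _)d2 /(_ _)d1 /(_ isT) d0.
  have {}d2 := d2 ltac:(apply/andP; split; lra).
  have {}d1 := d1 ltac:(apply/andP; split; lra).
  move: d0 d1 d2; rewrite !ltr_norml => /andP[? ?] /andP[? ?] /andP[? ?].
  set B := f (t p + 2 * s) - 2 * f (t p + s) + f (t p).
  have B1 : B <= `|B| := ler_norm _.
  have B2 : - B <= `|B| by rewrite -normrN ler_norm.
  rewrite ler_norml; move: B1 B2; rewrite /B => B1 B2; apply/andP; split; lra.
have H := @integral_le_step R t t_nd M (fun x => `|Delta2 f s x|) c
  (fun x => normr_ge0 _) c0 gc.
rewrite t0 tM in H.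
have fin : DInt f j (l%:R / 2 ^+ k) (l.+1%:R / 2 ^+ k) \is a fin_num.
  by rewrite ge0_fin_numE ?DInt_ge0// (le_lt_trans H)// ltry.
rewrite /cell_avg mulrC -ler_pdivlMr//.
rewrite -lee_fin fineK//; apply: le_trans H _; rewrite lee_fin.
rewrite ler_pdivlMr// mulr_suml.
rewrite (eq_bigr (fun p : 'I_M => c p / M%:R)); last first.
  move=> p _; rewrite tS (addrC (t p)) addrK -mulrA; congr (_ * _).
  by rewrite mulrC wid.
rewrite -mulr_suml big_split/= mulrDl sumr_const card_ord lerD2l.
by rewrite -[4 * e *+ M]mulr_natr mulfK// gt_eqF.
Qed.

(** By the parallelogram identity the slack is exactly [(f (x + 2 s) - f x) ^ 2]. *)
Lemma sqr_second_diff_le f (s x : R) :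
  `|second_diff f s x| ^+ 2 <=
  2 * (f (x + 2 * s) - f (x + s)) ^+ 2 + 2 * (f (x + s) - f x) ^+ 2.
Proof.
rewrite real_normK ?num_real// /second_diff.
have := sqr_ge0 (f (x + 2 * s) - f x).
set a := f (x + 2 * s); set b := f (x + s); set c := f x; nra.
Qed.

End PathOrlicz.

(** * From increments on shifted grids to the Orlicz norm of a path *)

Section ShiftedIncrements.
Context d (T : measurableType d) (R : realType).
Variables (W : R -> T -> R).

Definition incr (v s : R) (i : nat) (w : T) : R := W (s + i.+1%:R * v) w - W (s + i%:R * v) w.

Definition offset_avg (j k N : nat) (w : T) : R :=
  (\sum_(q < N) block_avg (2 ^ (j - k)) (2 ^ k) (step R j)
     (incr (step R j) (q%:R * (step R j / N%:R))) w) / N%:R.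

Lemma block_expE (m L l : nat) (v : R) (X : nat -> T -> R) (w : T) : (l < L)%N ->
  block_exp m L v X l w
  = expR (12 / 49 / v * \sum_(i < (2 * m).+1) X (2 * m * l + i)%N w ^+ 2).
Proof.
move=> lL; rewrite /block_exp /sq_exp -expR_sum; congr expR.
have bn : (2 * m * l + (2 * m).+1 <= (2 * m * L).+1)%N.
  by rewrite addnS ltnS -{2}[(2 * m)%N]muln1 -mulnDr addn1 leq_mul2l lL orbT.
rewrite mulr_sumr.
have := sum_if_itv (fun i => 12 / 49 / v * X i w ^+ 2) bn => /= <-.
apply: eq_bigr => i _; rewrite /block; case: ifP => _; rewrite ?mul0r// mul1r.
by rewrite [X in _ * X]mulrC mulrA.
Qed.

Lemma riemann_exp_le (j k l N : nat) (w : T) : (k <= j)%N -> (l < 2 ^ k)%N -> (0 < N)%N ->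
  let M := (2 * 2 ^ (j - k) * N)%N in
  let s := step R j in
  let Y := Num.sqrt (2 ^+ j) * ((\sum_(p < M)
    `|second_diff (W ^~ w) s (l%:R / 2 ^+ k + p%:R * (s / N%:R))|) / M%:R) in
  is_true (expR (10 * (2 ^ (j - k))%:R * (Y / 7) ^+ 2)
   <= (\sum_(q < N) block_exp (2 ^ (j - k)) (2 ^ k) s (incr s (q%:R * (s / N%:R))) l w) / N%:R).
Proof.
move=> kj lk N0 M s Y; set m := (2 ^ (j - k))%N.
have s0 : 0 < s := step_gt0 R j.
have m0 : (0 < m)%N by rewrite expn_gt0.
have mR : 0 < m%:R :> R by rewrite ltr0n.
have NR : 0 < N%:R :> R by rewrite ltr0n.
have M0 : (0 < M)%N by rewrite !muln_gt0 expn_gt0.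
have MR : 0 < M%:R :> R by rewrite ltr0n.
have ME : M%:R = 2 * m%:R * N%:R :> R by rewrite !natrM.
have sE : 2 ^+ j = (2 * s)^-1 :> R by rewrite /s /step exprS invfM invrK mulKf.
have aE : l%:R / 2 ^+ k = (2 * m * l)%:R * s :> R.
  rewrite /s /step /m !natrM natrX -{2}(subnK kj) exprS exprD; field.
  by rewrite !expf_neq0.
pose X q i := incr s (q%:R * (s / N%:R)) i w.
pose D q := \sum_(i < (2 * m).+1) X q (2 * m * l + i)%N ^+ 2.
rewrite (eq_bigr (fun q : 'I_N => expR (12 / 49 / s * D q))); last first.
  by move=> q _; rewrite block_expE.
apply: le_trans (expR_mean_le (fun q => 12 / 49 / s * D q) N0); rewrite ler_expR.
pose F p := `|second_diff (W ^~ w) s (l%:R / 2 ^+ k + p%:R * (s / N%:R))|.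
(* With [p = i * N + q] the grid point has offset number [q] and step number [i]. The factor 4 is 2
   from [sqr_second_diff_le] times 2, as an increment belongs to at most two second differences. *)
have F2 : \sum_(p < M) F p ^+ 2 <= 4 * \sum_(q < N) D q.
  rewrite /M (sum_mul_ord _ _ (fun p => F p ^+ 2)) exchange_big/= mulr_sumr.
  apply: ler_sum => q _.
  have Fle i : F (i * N + q)%N ^+ 2
      <= 2 * X q (2 * m * l + i.+1)%N ^+ 2 + 2 * X q (2 * m * l + i)%N ^+ 2.
    rewrite /F; apply: le_trans (sqr_second_diff_le _ _ _) _.
    have -> : l%:R / 2 ^+ k + (i * N + q)%:R * (s / N%:R)
        = q%:R * (s / N%:R) + (2 * m * l + i)%:R * s.
      by rewrite aE !natrD natrM; field; rewrite gt_eqF.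
    rewrite /X /incr !addnS.
    have S1 (n : nat) : q%:R * (s / N%:R) + n.+1%:R * s = q%:R * (s / N%:R) + n%:R * s + s.
      by rewrite -[n.+1%:R]natr1 mulrDl mul1r addrA.
    rewrite !S1; set u := q%:R * (s / N%:R) + (2 * m * l + i)%:R * s.
    by rewrite (_ : u + 2 * s = u + s + s)//; ring.
  apply: (@le_trans _ _ (\sum_(i < 2 * m) (2 * X q (2 * m * l + i.+1)%N ^+ 2
    + 2 * X q (2 * m * l + i)%N ^+ 2))); first by apply: ler_sum => i _; exact: Fle.
  rewrite big_split/= -!mulr_sumr /D.
  have E1 : \sum_(i < 2 * m) X q (2 * m * l + i)%N ^+ 2 <=
      \sum_(i < (2 * m).+1) X q (2 * m * l + i)%N ^+ 2.
    by rewrite big_ord_recr/= lerDl sqr_ge0.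
  have E2 : \sum_(i < 2 * m) X q (2 * m * l + i.+1)%N ^+ 2 <=
      \sum_(i < (2 * m).+1) X q (2 * m * l + i)%N ^+ 2.
    by rewrite big_ord_recl/= lerDr sqr_ge0.
  lra.
have CS := sqr_sum_le M F.
have Y2 : Y ^+ 2 <= 2 ^+ j / M%:R * (4 * \sum_(q < N) D q).
  rewrite /Y exprMn sqr_sqrtr ?exprn_ge0// -mulrA ler_wpM2l ?exprn_ge0//.
  rewrite exprMn exprVn mulrC ler_pdivrMl ?exprn_gt0//.
  apply: le_trans CS _; rewrite expr2 -mulrA ler_wpM2l ?(ltW MR)//.
  by rewrite mulVKf ?gt_eqF.
have D0 : 0 <= \sum_(q < N) D q.
  by apply: sumr_ge0 => q _; apply: sumr_ge0 => i _; exact: sqr_ge0.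
rewrite -mulr_sumr.
have -> : 10 * m%:R * (Y / 7) ^+ 2 = 10 / 49 * m%:R * Y ^+ 2 by field.
apply: (@le_trans _ _ (10 / 49 * m%:R * (2 ^+ j / M%:R * (4 * \sum_(q < N) D q)))).
  by rewrite ler_wpM2l// mulr_ge0.
(* Since [2 ^ j = 1 / (2 s)] and [M = 2 m N], both [m] and the 4 cancel; the remaining [10/49] is
   below the [12/49] of [sq_exp]. *)
have -> : 10 / 49 * m%:R * (2 ^+ j / M%:R * (4 * \sum_(q < N) D q))
    = 10 / 49 / s * (\sum_(q < N) D q) / N%:R.
  by rewrite ME sE; field; rewrite !gt_eqF.
by rewrite ler_pM2r ?invr_gt0// ler_wpM2r// ler_pM2r ?invr_gt0//; lra.
Qed.

Lemma scale_paramE (j k : nat) : (k <= j)%N -> 2 ^+ k / 2 ^+ j = (2 ^ (j - k))%:R^-1 :> R.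
Proof.
move=> kj; rewrite natrX -{1}(subnK kj) exprD invfM mulrCA divff ?mulr1//.
Qed.

(** At level 8, [Phi2_exp] bounds each cell by [1/2] plus its share of [offset_avg], so the total is
    at most 1. *)
Lemma eventually_orlicz_le (j k : nat) (w : T) : (k <= j)%N ->
  {within `[0, 2], continuous (W ^~ w)} ->
  exists N0 : nat, forall N, (N0 <= N)%N -> (0 < N)%N -> offset_avg j k N w <= 2^-1 ->
    (orlicz (2 ^+ k / 2 ^+ j) (fun x => (Num.sqrt (2 ^+ j) * D2 j k (W ^~ w) x)%R) <= 8%:E)%E.
Proof.
move=> kj cW; set m := (2 ^ (j - k))%N; set r := Num.sqrt (2 ^+ j).
have m0 : (0 < m)%N by rewrite expn_gt0.
have r0 : 0 < r by rewrite sqrtr_gt0 exprn_gt0.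
have K0 : 0 < 2 ^+ k :> R by rewrite exprn_gt0.
have s0 : 0 < step R j := step_gt0 R j.
(* With this [e] the Riemann error [4 * e], multiplied by [r], is [1/10]. *)
have e0 : 0 < (40 * r)^-1 by rewrite invr_gt0 mulr_gt0.
have [del del0 mod_W] := unif_continuous_itv cW e0.
exists (Num.truncn (step R j / del)).+1 => N N0N N0 QN.
have NR : 0 < N%:R :> R by rewrite ltr0n.
have hN : step R j / N%:R < del.
  rewrite ltr_pdivrMr// mulrC -ltr_pdivrMr//.
  by apply: lt_le_trans (truncnS_gt _) _; rewrite ler_nat.
have A01 := orlicz_scale_param R kj.
apply: ereal_inf_lbound; exists 8 => //; split=> //.
rewrite integral_Phi2_D2// lee_fin.
pose be q l := block_exp m (2 ^ k) (step R j) (incr (step R j) (q%:R * (step R j / N%:R))) l w.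
have cell l : (l < 2 ^ k)%N -> Phi2 (2 ^+ k / 2 ^+ j) (r * cell_avg (W ^~ w) j k l / 8)
    <= 2^-1 + 32 ^- m * ((\sum_(q < N) be q l) / N%:R).
  move=> lk.
  have ca := cell_avg_le_riemann (erefl (2 * 2 ^ (j - k) * N)%N) kj lk N0 mod_W e0 hN.
  have := riemann_exp_le w kj lk N0; cbv zeta.
  set Y := Num.sqrt _ * _ => hY.
  have XY : r * cell_avg (W ^~ w) j k l <= Y + 10^-1.
    rewrite /Y -/r; apply: (@le_trans _ _ (r * (_ + 4 * (40 * r)^-1))).
      by rewrite ler_wpM2l ?(ltW r0)//; exact: ca.
    by rewrite mulrDr lerD2l le_eqVlt; apply/orP; left; apply/eqP; field; rewrite gt_eqF.
  have u0 : 0 <= r * cell_avg (W ^~ w) j k l / 8.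
    by rewrite divr_ge0// mulr_ge0 ?(ltW r0)// cell_avg_ge0.
  have rhs0 : 0 <= 32 ^- m * ((\sum_(q < N) be q l) / N%:R).
    rewrite mulr_ge0// divr_ge0//; apply: sumr_ge0 => q _; exact: block_exp_ge0.
  move: XY u0; set x := r * _ => XY u0.
  (* Up to [7/10] the square is below [1/2]. Beyond, [x] is large enough for
     [x / 8 <= (x - 1/10) / 7], so lowering 8 to 7 absorbs the Riemann error. *)
  have [u2|u2] := leP (x / 8) (7 / 10).
    rewrite Phi2_le1; last by apply/andP; split=> //; lra.
    by apply: (@le_trans _ _ 2^-1); [nra|rewrite lerDl].
  apply: (@le_trans _ _ (Phi2 (2 ^+ k / 2 ^+ j) (Y / 7))).
    by apply: le_Phi2 => //; lra.
  rewrite scale_paramE//; apply: le_trans (Phi2_exp m0 _) _; first by lra.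
  by rewrite lerD2l ler_wpM2l.
apply: (@le_trans _ _ (2 ^- k * \sum_(l < 2 ^ k) (2^-1 + 32 ^- m * ((\sum_(q < N) be q l) / N%:R)))).
  by rewrite ler_wpM2l ?invr_ge0 ?(ltW K0)//; apply: ler_sum => l _; exact: cell.
have QE : offset_avg j k N w = 2 ^- k * \sum_(l < 2 ^ k) 32 ^- m * ((\sum_(q < N) be q l) / N%:R).
  rewrite /offset_avg /block_avg -!mulr_sumr -mulr_suml exchange_big/=.
  have -> : (2 ^ k)%:R = 2 ^+ k :> R by rewrite natrX.
  by rewrite /be -/m !mulrA [32 ^- m * _]mulrC.
rewrite big_split/= mulrDr -QE sumr_const card_ord -[2^-1 *+ _]mulr_natl natrX mulKf ?gt_eqF//.
lra.
Qed.

End ShiftedIncrements.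

Lemma le_triangle_sum (R : realDomainType) (o : nat -> nat -> \bar R) (n j k : nat) :
  (forall i l, (0 <= o i l)%E) -> (j < n)%N -> (k <= j)%N ->
  (o j k <= \sum_(i < n) \sum_(l < n | (l <= i)%N) o i l)%E.
Proof.
move=> o0 jn kj; have kn := leq_ltn_trans kj jn.
rewrite (bigD1 (Ordinal jn))//= (bigD1 (Ordinal kn))//= -addeA leeDl// adde_ge0//.
  exact: sume_ge0.
by apply: sume_ge0 => i _; exact: sume_ge0.
Qed.

(** * Probability estimates for the Wiener process and Borel-Cantelli *)

Section WienerTail.
Context d (T : measurableType d) (R : realType) (P : probability T R).
Variable W : R -> T -> R.
Hypothesis hW : wiener_process P W.

Let time_gt0 (s v : R) (i : nat) : 0 <= s -> 0 < v -> 0 <= s + i%:R * v.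
Proof. by move=> s0 v0; rewrite addr_ge0// mulr_ge0// ltW. Qed.

Lemma measurable_incr (s v : R) (i : nat) : 0 <= s -> 0 < v ->
  measurable_fun setT (incr W v s i).
Proof.
move=> s0 v0; have [mW _ _ _ _] := hW.
by apply: measurable_funB; apply: mW; exact: time_gt0.
Qed.

Let incr_mem (s v : R) (i : nat) (B : set R) :
  [set w | W (s + i.+1%:R * v) w - W (s + i%:R * v) w \in B] = incr W v s i @^-1` B.
Proof. by apply/seteqP; split => w /=; rewrite inE. Qed.

Lemma incr_law (s v : R) (i : nat) (B : set R) : 0 <= s -> 0 < v -> measurable B ->
  P (incr W v s i @^-1` B) = normal_prob 0 (Num.sqrt v) B.
Proof.
move=> s0 v0 mB; have [_ _ _ _ law] := hW.
have lt_t : s + i%:R * v < s + i.+1%:R * v by rewrite ltrD2l ltr_pM2r// ltr_nat.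
rewrite -incr_mem (law _ _ B (time_gt0 i s0 v0) lt_t mB); congr (normal_prob 0 (Num.sqrt _) B).
by rewrite -[i.+1%:R]natr1; ring.
Qed.

Lemma incr_indep (s v : R) (n : nat) (B : nat -> set R) : 0 <= s -> 0 < v ->
  (forall i, (i < n)%N -> measurable (B i)) ->
  P (\bigcap_(i in [set i | (i < n)%N]) (incr W v s i @^-1` B i))
  = \big[*%E/1%E]_(i < n) P (incr W v s i @^-1` B i).
Proof.
move=> s0 v0 mB; have [_ _ _ ind _] := hW.
have := ind n (fun i => s + i%:R * v) B (time_gt0 0 s0 v0) _ mB.
under eq_bigcapr do rewrite incr_mem; under eq_bigr do rewrite incr_mem.
by apply => i _; rewrite ltrD2l ltr_pM2r// ltr_nat.
Qed.

Lemma measurable_offset_avg (j k N : nat) : measurable_fun setT (offset_avg W j k N).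
Proof.
have v0 := step_gt0 R j.
apply: measurable_funM => //; apply: measurable_sum => q.
apply: measurable_block_avg => i _; apply: measurable_incr => //.
by rewrite mulr_ge0// divr_ge0// ltW.
Qed.

(** As [m * 2 ^ k = 2 ^ j], the variance bound becomes [3 / 2 ^ j], uniformly in [k] and [N];
    [tail_average] multiplies it by 16. *)
Lemma offset_avg_tail (j k N : nat) : (k <= j)%N -> (0 < N)%N ->
  (P [set w | 2^-1 < offset_avg W j k N w]%R <= (48 / 2 ^+ j)%:E)%E.
Proof.
move=> kj N0; have v0 := step_gt0 R j; set m := (2 ^ (j - k))%N.
have m0 : (0 < m)%N by rewrite expn_gt0.
have L0 : (0 < 2 ^ k)%N by rewrite expn_gt0.
have s0 (q : nat) : 0 <= q%:R * (step R j / N%:R).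
  by rewrite mulr_ge0// divr_ge0// ltW.
rewrite (_ : 48 / 2 ^+ j = 16 * (3 / 2 ^+ j)); last by ring.
apply: (@tail_average _ _ _ _ _ (fun q => block_avg m (2 ^ k) (step R j)
   (incr W (step R j) (q%:R * (step R j / N%:R))))
   (32 ^- m * (7 / 5) ^+ (2 * m).+1)) => //.
- by rewrite block_avg_mean_le// andbT mulr_ge0.
- by move=> q; apply: measurable_block_avg => i _; exact: measurable_incr.
- by move=> q w; exact: block_avg_ge0.
- move=> q; apply: integral_block_avg => //.
  + by move=> i _; exact: measurable_incr.
  + by move=> B mB; exact: incr_indep.
  + by move=> i B _ mB; exact: incr_law.
- move=> q; apply: le_trans (integral_block_avg_sqr m0 L0 v0 _ _ _) _.
  + by move=> i _; exact: measurable_incr.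
  + by move=> B mB; exact: incr_indep.
  + by move=> i B _ mB; exact: incr_law.
  + rewrite lee_fin lerD2l -mulrA ler_wpM2l//.
    rewrite -[leRHS]mul1r.
    have -> : 2 ^+ j = m%:R * (2 ^ k)%:R :> R by rewrite -natrM -expnD subnK// natrX.
    rewrite mul1r invfM ler_wpM2r ?invr_ge0//; exact: block_avg_var_le.
Qed.

(* One grid size [N] with average at most [1 / 2], fine enough for the path at hand, suffices
   in [eventually_orlicz_le]; the exceptional event is therefore only a [liminf] over [N]. *)
Definition bad (j k : nat) : set T :=
  \bigcup_n \bigcap_(N in [set N | (n <= N)%N]) [set w | 2^-1 < offset_avg W j k N.+1 w].

Let measurable_offset_gt j k N : measurable [set w | 2^-1 < offset_avg W j k N w].
Proof.
rewrite (_ : [set w | _] = [set: T] `&` offset_avg W j k N @^-1` `]2^-1, +oo[%classic).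
  by apply: measurable_offset_avg => //; exact: measurable_itv.
by rewrite setTI; apply/seteqP; split => w /=; rewrite in_itv/= andbT.
Qed.

Let measurable_tail j k n : measurable
  (\bigcap_(N in [set N | (n <= N)%N]) [set w | 2^-1 < offset_avg W j k N.+1 w]).
Proof. by apply: bigcap_measurableType => N _; exact: measurable_offset_gt. Qed.

Lemma measurable_bad j k : measurable (bad j k).
Proof. by apply: bigcup_measurable => n _; exact: measurable_tail. Qed.

(** The intersections increase with [n], and the [n]-th lies in the single event for the grid size
    [n + 1]; continuity from below keeps the bound. *)
Lemma bad_le (j k : nat) : (k <= j)%N -> (P (bad j k) <= (48 / 2 ^+ j)%:E)%E.
Proof.
move=> kj.
pose F n := \bigcap_(N in [set N | (n <= N)%N]) [set w | 2^-1 < offset_avg W j k N.+1 w].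
have ndF : nondecreasing_seq F.
  move=> n p np; apply/subsetPset => w hw N /= pN; apply: hw => /=; exact: leq_trans pN.
have cv : P \o F @ \oo --> P (bad j k).
  by apply: nondecreasing_cvg_mu => // [n|]; [exact: measurable_tail|exact: measurable_bad].
rewrite -(cvg_lim _ cv)//; apply: lime_le; first by apply/cvg_ex; eexists; exact: cv.
apply: nearW => n; apply: le_trans (offset_avg_tail kj (ltn0Sn n)).
apply: le_measure; rewrite ?inE; [exact: measurable_tail|exact: measurable_offset_gt|].
by move=> w; apply => /=.
Qed.

Definition bad_level (j : nat) : set T := \big[setU/set0]_(k < j.+1) bad j k.

Lemma measurable_bad_level j : measurable (bad_level j).
Proof. by apply: bigsetU_measurable => k _; exact: measurable_bad. Qed.

Lemma bad_level_le j : (P (bad_level j) <= (48 * (j.+1%:R / 2 ^+ j))%:E)%E.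
Proof.
apply: (@le_trans _ _ (\sum_(k < j.+1) P (bad j k))%E).
  by apply: Boole_inequality => k _; exact: measurable_bad.
apply: (@le_trans _ _ (\sum_(k < j.+1) (48 / 2 ^+ j)%:E)%E).
  by apply: lee_sum => k _; apply: bad_le; rewrite -ltnS.
by rewrite sumEFin sumr_const card_ord lee_fin -[_ *+ _]mulr_natl mulrCA.
Qed.

Lemma summable_bad_level : (\sum_(j <oo) P (bad_level j) < +oo)%E.
Proof.
(* 192 is 48 times 4, the sum of the series of [(j + 1) / 2 ^ j]. *)
apply: (@le_lt_trans _ _ 192%:E); last exact: ltry.
apply: lime_le; first by apply: is_cvg_nneseries.
apply: nearW => n; rewrite big_mkord.
apply: (@le_trans _ _ (\sum_(j < n) (48 * (j.+1%:R / 2 ^+ j))%:E)%E).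
  by apply: lee_sum => j _; exact: bad_level_le.
rewrite sumEFin lee_fin -mulr_sumr.
have -> : \sum_(j < n) (j.+1%:R / 2 ^+ j : R) = 4 - 2 * (n%:R + 2) / 2 ^+ n.
  elim: n => [|n IH]; first by rewrite big_ord0; field.
  by rewrite big_ord_recr/= IH -!natr1 exprS; field; rewrite expf_neq0.
have : 0 <= 2 * (n%:R + 2) / 2 ^+ n :> R by rewrite divr_ge0 ?exprn_ge0// mulr_ge0// addr_ge0.
lra.
Qed.

(** By Borel-Cantelli almost every path meets only finitely many bad levels; outside [bad j k]
    arbitrarily fine grids have average at most [1/2]. *)
Lemma ae_eventually_not_bad :
  {ae P, forall w, exists n, forall j k N, (n <= j)%N -> (k <= j)%N ->
    exists2 N', (N <= N')%N & offset_avg W j k N'.+1 w <= 2^-1}.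
Proof.
exists (lim_sup_set bad_level); split.
- by apply: bigcap_measurableType => n _; apply: bigcup_measurable => j _;
    exact: measurable_bad_level.
- apply: lim_sup_set_cvg0; [exact: measurable_bad_level|exact: summable_bad_level].
move=> w /= hw n _; apply: contrapT => hn; apply: hw.
exists n => j k N nj kj; apply: contrapT => hN; apply: hn.
exists j => //; apply: (bigsetU_sup (F := bad j) (i := k)); first by rewrite ltnS.
exists N => // N' /= NN'; rewrite ltNge; apply/negP => le2; apply: hN.
by exists N'.
Qed.

Lemma ae_normD_lty : {ae P, forall w, (normD (fun t => W t w) < +oo)%E}.
Proof.
have [_ _ cW _ _] := hW; move: cW ae_eventually_not_bad; apply: filterS2 => w cw [n hn].
have c2 : {within `[0, 2], continuous (W ^~ w)}.
  apply: continuous_subspaceW cw => x /=; rewrite !in_itv/= => /andP[-> _] //.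
pose o (j k : nat) := orlicz (2 ^+ k / 2 ^+ j) (fun x => Num.sqrt (2 ^+ j) * D2 j k (W ^~ w) x).
have o0 j k : (0 <= o j k)%E.
  by apply: le_ereal_inf_tmp => _ [lam [lam0 _] <-]; rewrite lee_fin ltW.
(* The bound 8 holds for all levels from [n] on; the finite sum covers the earlier ones. *)
pose B := (8%:E + \sum_(j < n) \sum_(k < n | (k <= j)%N) o j k)%E.
apply: (@le_lt_trans _ _ B).
  apply: ge_ereal_sup => _ [[j k] /= kj <-]; rewrite -/(o j k) /B.
  have S0 : (0 <= \sum_(j < n) \sum_(k < n | (k <= j)%N) o j k)%E.
    by apply: sume_ge0 => i _; exact: sume_ge0.
  have [jn|nj] := ltnP j n.
    by apply: le_trans (le_triangle_sum o0 jn kj) _; rewrite leeDr// lee_fin.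
  apply: (@le_trans _ _ 8%:E); last exact: leeDl.
  have [N0 hN0] := eventually_orlicz_le kj c2.
  have [N' N0N' le2] := hn j k N0 nj kj.
  by apply: (hN0 N'.+1) => //; exact: leqW.
rewrite /B lte_add_pinfty ?ltry//; apply: lte_sum_pinfty => j _.
apply: lte_sum_pinfty => k kj; apply: orlicz_D2_lty; exact: orlicz_scale_param.
Qed.

End WienerTail.

Theorem theorem2p12 (R : realType) :
  (exists c C : R, 0 < c /\ c <= C /\
     forall f : R -> R, {within `[0, 1], continuous f} ->
       (c%:E * normD f <= normfD f)%E /\ (normfD f <= C%:E * normD f)%E)
  /\ (forall (d : measure_display) (T : measurableType d)
        (P : probability T R) (W : R -> T -> R),
        wiener_process P W -> {ae P, forall w, (normD (fun t => W t w) < +oo)%E})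
  /\ (forall (d : measure_display) (T : measurableType d)
        (P : probability T R) (W : R -> T -> R),
        wiener_process P W -> {ae P, forall w, (normfD (fun t => W t w) < +oo)%E}).
Proof.
have cW d (T : measurableType d) (P : probability T R) (W : R -> T -> R) :
    wiener_process P W -> {ae P, forall w, {within `[0, 1], continuous (fun t => W t w)}}.
  move=> [_ _ cw _ _]; move: cw; apply: filterS => w.
  by apply: continuous_subspaceW => x /=; rewrite !in_itv/= => /andP[->].
split; last split.
(* The constants come from [normD_le], inverted, and [normfD_le]. *)
- exists 4^-1, 6; split; first by rewrite invr_gt0.
  split; first by rewrite (@le_trans _ _ 1)// ?invf_le1// ler1n.
  move=> f cf; split; last exact: normfD_le.
  by rewrite lee_pdivrMl//; exact: normD_le.
- by move=> d T P W hW; exact: ae_normD_lty.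
- move=> d T P W hW; move: (cW _ _ _ _ hW) (ae_normD_lty hW); apply: filterS2 => w cw hD.
  apply: le_lt_trans (normfD_le cw) _.
  by rewrite lte_mul_pinfty// lee_fin.
Qed.
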